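(* Let $T_{32}$ be the mixed trace algebra generated by the generic $3\times 3$ matrices $X,Y$, with pure trace algebra $C_{32}$, and let $$x=X-\tfrac13\operatorname{tr}(X)e,\qquad y=Y-\tfrac13\operatorname{tr}(Y)e .$$ Let $G=G_0\oplus G_1\oplus\cdots\oplus G_5$, where $G_k\subset T_{32}$ is the $GL_2$-submodule generated by the elements of degree $k$ among $$u_{(0,0)}=1,\quad u_{(1,0)}=x,\quad u_{(2,0)}=x^2,\quad u_{(1,1)}=[x,y],\quad u'_{(2,1)}=[x,y]x,\quad u''_{(2,1)}=[x^2,y],$$ $$u_{(3,1)}=[x,y]x^2,\quad u_{(2,2)}=[x,y]^2,\quad u_{(3,2)}=[x,y]^2x .$$ (i) As a $GL_2$-module $$G\cong W(0,0)\oplus W(1,0)\oplus W(2,0)\oplus W(1,1)\oplus 2W(2,1)\oplus W(3,1)\oplus W(2,2)\oplus W(3,2),$$ and the vector space $G$ generates $T_{32}$ as a $C_{32}$-module. (ii) Let $$v=\operatorname{tr}(x^2y^2)-\operatorname{tr}(xyxy),\qquad w=\operatorname{tr}(x^2y^2xy)-\operatorname{tr}(y^2x^2yx),$$ let $S$ be the subalgebra of $C_{32}$ $$S=K[\operatorname{tr}(X),\operatorname{tr}(Y),\operatorname{tr}(x^2),\operatorname{tr}(xy),\operatorname{tr}(y^2),\operatorname{tr}(x^3),\operatorname{tr}(x^2y),\operatorname{tr}(xy^2),\operatorname{tr}(y^3),v]$$ generated by the ten listed elements, and let $G_6=Kw$. Then $S$ is isomorphic to the polynomial algebra in ten variables and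 $T_{32}$ is a free $S$-module. Any basis of the vector space $G\oplus G_6$ serves as a set of free generators of the $S$-module $T_{32}$.
   Context: $K$ is a field of characteristic $0$; $\Omega$ is the polynomial algebra over $K$ in the $18$ independent commuting variables $x_{pq},y_{pq}$ ($1\le p,q\le 3$); $X=(x_{pq})$ and $Y=(y_{pq})$ are the two generic $3\times3$ matrices in $M_3(\Omega)$; $e$ is the identity $3\times 3$ matrix. $C_{32}$ (pure trace algebra) is the $K$-subalgebra of $\Omega$ generated by all traces of products of $X$ and $Y$; its elements are identified with scalar matrices (so the number $1$ is identified with $e$). $T_{32}$ (mixed trace algebra) is the $K$-subalgebra of $M_3(\Omega)$ generated by $X$, $Y$ and $C_{32}$. Degrees (and bidegrees) are counted with respect to $X$ and $Y$, equivalently with respect to the entries. $[a,b]=ab-ba$. The group $GL_2=GL_2(K)$ acts on $T_{32}$ as follows: $g=(g_{ij})$ acts on $\Omega$ by the $K$-algebra automorphism sending the entries of $X$ and $Y$ to the corresponding entries of $g_{11}X+g_{21}Y$ and $g_{12}X+g_{22}Y$, and it acts on matrices over $\Omega$ entrywise; then $x\mapsto g_{11}x+g_{21}y$, $y\mapsto g_{12}x+g_{22}y$, and $T_{32}$ is stable. For $\lambda=(\lambda_1,\lambda_2)$ with $\lambda_1\ge\lambda_2\ge0$, $W(\lambda)$ is the irreducible polynomial $GL_2$-module corresponding to $\lambda$, whose character is the Schur function $S_\lambda(t_1,t_2)$; $2W(\lambda)=W(\lambda)\oplus W(\lambda)$. *)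

(* Defs.v *)
From HB Require Import structures.
From mathcomp Require Import all_boot all_order all_algebra.
From mathcomp Require Export mpoly.

Set Implicit Arguments.
Unset Strict Implicit.
Unset Printing Implicit Defensive.

Import GRing.Theory.
Local Open Scope ring_scope.

(* Subobjects (subalgebras, subspaces, submodules) are predicates [A -> Prop]
   on the ambient ring. *)

(* The K-subalgebra of A generated by S; iota is the structure map K -> A. *)
Inductive subalg (K : fieldType) (A : nzRingType) (iota : K -> A)
    (S : A -> Prop) : A -> Prop :=
| subalg_gen a : S a -> subalg iota S a
| subalg_cst c : subalg iota S (iota c)
| subalg_add a b : subalg iota S a -> subalg iota S b -> subalg iota S (a + b)
| subalg_mul a b : subalg iota S a -> subalg iota S b -> subalg iota S (a * b).

Definition bracket (A : nzRingType) (a b : A) : A := a * b - b * a.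

(* 18 variables: the first 9 are the x_pq, the last 9 the y_pq, each block
   indexed by the pairs (p, q) through mxvec_index. *)
Definition nvar : nat := (3 * 3 + 3 * 3)%N.

Definition Omega (K : fieldType) := {mpoly K[nvar]}.
Definition M3 (K : fieldType) := 'M[{mpoly K[nvar]}]_3.

Definition genX (K : fieldType) : M3 K :=
  \matrix_(p < 3, q < 3) 'X_(lshift (3 * 3) (mxvec_index p q)).
Definition genY (K : fieldType) : M3 K :=
  \matrix_(p < 3, q < 3) 'X_(rshift (3 * 3) (mxvec_index p q)).

(* Scaling of a matrix over Omega by an element of K. *)
Definition Kscale (K : fieldType) (c : K) (a : M3 K) : M3 K :=
  (@mpolyC nvar K c) *: a.

Definition word (K : fieldType) (s : seq bool) : M3 K :=
  \prod_(b <- s) (if b then genY K else genX K).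

Definition C32 (K : fieldType) : Omega K -> Prop :=
  subalg (@mpolyC nvar K) (fun p => exists s : seq bool, p = \tr (word K s)).

Definition T32 (K : fieldType) : M3 K -> Prop :=
  subalg (fun c : K => (@mpolyC nvar K c)%:M)
    (fun a => [\/ a = genX K, a = genY K | exists2 p, C32 p & a = p%:M]).

Definition subst_entries (K : fieldType) (A B : M3 K) (p : Omega K) : Omega K :=
  p \mPo [tuple row_mx (mxvec A) (mxvec B) ord0 i | i < 3 * 3 + 3 * 3].

(* The action of g \in GL_2(K), first on Omega, then entrywise on matrices. *)
Definition gl_poly (K : fieldType) (g : 'M[K]_2) : Omega K -> Omega K :=
  subst_entries
    (Kscale (g 0 0) (genX K) + Kscale (g 1 0) (genY K))
    (Kscale (g 0 1) (genX K) + Kscale (g 1 1) (genY K)).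

Definition gl_act (K : fieldType) (g : 'M[K]_2) (a : M3 K) : M3 K :=
  map_mx (gl_poly g) a.

(* The GL_2-submodule generated by U. *)
Inductive gl_submod (K : fieldType) (U : M3 K -> Prop) : M3 K -> Prop :=
| gl_submod_gen a : U a -> gl_submod U a
| gl_submod_zero : gl_submod U 0
| gl_submod_lin c a b :
    gl_submod U a -> gl_submod U b -> gl_submod U (Kscale c a + b)
| gl_submod_act g a : g \in unitmx -> gl_submod U a -> gl_submod U (gl_act g a).

(* Representations of GL_2(K) on column vectors; the values of rho outside
   unitmx are irrelevant. *)
Definition gl_rep (K : fieldType) (n : nat) (rho : 'M[K]_2 -> 'M[K]_n) : Prop :=
  rho 1%:M = 1%:M /\
  forall g h, g \in unitmx -> h \in unitmx -> rho (g *m h) = rho g *m rho h.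

Definition gl_polynomial (K : fieldType) (n : nat)
    (rho : 'M[K]_2 -> 'M[K]_n) : Prop :=
  exists P : 'M[{mpoly K[2 * 2]}]_n, forall g, g \in unitmx ->
    rho g = map_mx (meval (mxvec g ord0)) P.

Definition gl_irreducible (K : fieldType) (n : nat)
    (rho : 'M[K]_2 -> 'M[K]_n) : Prop :=
  (0 < n)%N /\
  forall U : {vspace 'cV[K]_n},
    (forall g v, g \in unitmx -> v \in U -> rho g *m v \in U) ->
    U = 0%VS \/ U = fullv.

(* The Schur function S_lambda(t1, t2) as the sum over semistandard tableaux
   of shape lambda with entries 1, 2: the first lambda_2 columns are forced and
   the rest of the first row has i entries equal to 2, for some
   i <= lambda_1 - lambda_2. *)
Definition schur2 (K : fieldType) (lam : nat * nat) (t1 t2 : K) : K :=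
  \sum_(i < (lam.1 - lam.2).+1) t1 ^+ (lam.1 - i) * t2 ^+ (lam.2 + i).

Definition diag2 (K : fieldType) (t1 t2 : K) : 'M[K]_2 :=
  diag_mx (\row_(i < 2) (if i == 0 then t1 else t2)).

Definition isW (K : fieldType) (lam : nat * nat) (n : nat)
    (rho : 'M[K]_2 -> 'M[K]_n) : Prop :=
  [/\ gl_rep rho, gl_polynomial rho, gl_irreducible rho
    & forall t1 t2, t1 != 0 -> t2 != 0 ->
        \tr (rho (diag2 t1 t2)) = schur2 lam t1 t2].

(* V is isomorphic, as a GL_2-module, to the direct sum of the W(lambda) for
   lambda in lams (with multiplicities): the isomorphism is given by its
   restrictions phi i to the summands. *)
Definition iso_sumW (K : fieldType) (V : M3 K -> Prop)
    (lams : seq (nat * nat)) : Prop :=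
  exists (n : 'I_(size lams) -> nat)
         (rho : forall i, 'M[K]_2 -> 'M[K]_(n i))
         (phi : forall i, 'cV[K]_(n i) -> M3 K),
  [/\ forall i, isW (tnth (in_tuple lams) i) (rho i),
      forall i c u v, phi i (c *: u + v) = Kscale c (phi i u) + phi i v,
      forall i g v, g \in unitmx -> phi i (rho i g *m v) = gl_act g (phi i v),
      forall a, V a <-> exists v : forall i, 'cV[K]_(n i), a = \sum_i phi i (v i)
    & forall v : forall i, 'cV[K]_(n i),
        \sum_i phi i (v i) = 0 -> forall i, v i = 0].

(* The R-submodule of M_3(Omega) spanned by V, for a subring R of Omega. *)
Inductive lin_span (K : fieldType) (R : Omega K -> Prop) (V : M3 K -> Prop) :
    M3 K -> Prop :=
| lin_span_zero : lin_span R V 0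
| lin_span_add p a b :
    R p -> V a -> lin_span R V b -> lin_span R V (p *: a + b).

(* b is a basis of the R-module V (a set of free generators). *)
Definition is_basis (K : fieldType) (R : Omega K -> Prop) (V : M3 K -> Prop)
    (n : nat) (b : 'I_n -> M3 K) : Prop :=
  (forall a, V a <->
     exists2 p : 'I_n -> Omega K, forall i, R (p i) & a = \sum_i p i *: b i) /\
  (forall p : 'I_n -> Omega K, (forall i, R (p i)) ->
     \sum_i p i *: b i = 0 -> forall i, p i = 0).

Definition constants (K : fieldType) (p : Omega K) : Prop :=
  exists c : K, p = @mpolyC nvar K c.

Definition tlX (K : fieldType) : M3 K :=
  genX K - Kscale 3%:R^-1 (\tr (genX K))%:M.
Definition tlY (K : fieldType) : M3 K :=
  genY K - Kscale 3%:R^-1 (\tr (genY K))%:M.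

(* The elements u_lambda; the degree of u_lambda is lambda_1 + lambda_2. *)
Definition ulist (K : fieldType) : seq ((nat * nat) * M3 K) :=
  let x := tlX K in let y := tlY K in
  [:: ((0, 0)%N, 1);
      ((1, 0)%N, x);
      ((2, 0)%N, x ^+ 2);
      ((1, 1)%N, bracket x y);
      ((2, 1)%N, bracket x y * x);
      ((2, 1)%N, bracket (x ^+ 2) y);
      ((3, 1)%N, bracket x y * x ^+ 2);
      ((2, 2)%N, bracket x y ^+ 2);
      ((3, 2)%N, bracket x y ^+ 2 * x)].

Definition Gdeg (K : fieldType) (k : nat) : M3 K -> Prop :=
  gl_submod (fun a => exists lam : nat * nat,
    (lam, a) \in ulist K /\ (lam.1 + lam.2)%N = k).

Definition Gsp (K : fieldType) (a : M3 K) : Prop :=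
  exists2 f : 'I_6 -> M3 K, forall k : 'I_6, Gdeg k (f k) & a = \sum_k f k.

Definition vtr (K : fieldType) : Omega K :=
  let x := tlX K in let y := tlY K in
  \tr (x ^+ 2 * y ^+ 2) - \tr (x * y * x * y).

Definition wtr (K : fieldType) : Omega K :=
  let x := tlX K in let y := tlY K in
  \tr (x ^+ 2 * y ^+ 2 * x * y) - \tr (y ^+ 2 * x ^+ 2 * y * x).

Definition Salg (K : fieldType) : Omega K -> Prop :=
  let x := tlX K in let y := tlY K in
  subalg (@mpolyC nvar K) (fun p => p \in
    [:: \tr (genX K); \tr (genY K);
        \tr (x ^+ 2); \tr (x * y); \tr (y ^+ 2);
        \tr (x ^+ 3); \tr (x ^+ 2 * y); \tr (x * y ^+ 2); \tr (y ^+ 3);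
        vtr K]).

Definition G6 (K : fieldType) (a : M3 K) : Prop :=
  exists c : K, a = Kscale c (wtr K)%:M.

Definition GG6 (K : fieldType) (a : M3 K) : Prop :=
  exists a1 a2, [/\ Gsp a1, G6 a2 & a = a1 + a2].

(* Main.v *)
(* Spanning. The polarized Cayley-Hamilton identity F(a, b, c) = 0, taken at words
   in x and y and multiplied by words, first puts all traces of words of length at
   most 5 in S and those of length 6 in S + S w; with the trace terms discarded as
   lower order, it then rewrites the product of each of the 17 basis elements of G
   by x or y in terms of basis elements of the next degree (words of length 6
   reduce to multiples of w). One more instance of F shows that w x and w y are
   also in the S-span of the 18 elements, which is therefore a ring containing X,
   Y and all traces, hence equal to T_32.

   Independence. Transposing X and Y is an automorphism of Omega that reverses the
   words inside traces; it fixes S and maps w to - w. Applied to a product of two of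
   the 18 elements, tr - (transposed tr) vanishes in degree less than 6 and is an
   integer multiple of w in degree 6, so the Gram matrix of this form is block
   triangular with constant blocks, and those are invertible.

   The ten generators of S are algebraically independent by the Jacobian criterion
   at a point with integer entries. The GL_2-structure of G is read off the explicit
   equivariant bases of its summands det^k (x) Sym^m with m <= 2. *)

Require Import Defs.
From mathcomp Require Import all_boot all_order all_algebra.
From mathcomp Require Import ring zify.
Set Implicit Arguments.
Unset Strict Implicit.
Unset Printing Implicit Defensive.
Import GRing.Theory.
Local Open Scope ring_scope.

(** Spanning is not a matter of word length alone, because modulo S a trace of length 6 is known
    only up to a multiple of w. The coefficient of w e in a word of length 6 is found by taking its
    trace, and comparing coefficients there already needs 1 and w to be independent over S.
    Transposition supplies this small piece of independence ([w_free]), so spanning rests on it. The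
    coefficient is chirality / 6 for the word but chirality / 2 for its trace, and this mismatch is
    what produces w x and w y.

    Reductions take place over an abstract commutative ring with a subring S in which nonzero
    integers are invertible. Each of them is then an integer identity between words, verified by
    computation. Lengths above 7 never have to be examined: once w x and w y are in the span, it is
    stable under right multiplication by x and y.

    The 18 elements number 1, 2, 4, 4, 4, 2, 1 in degrees 0 to 6; the symmetry matches a form that
    pairs degree d with degree 6 - d. The claim about an arbitrary basis of G + K w follows from one
    basis, by transition matrices with constant entries. *)

Local Notation X := false.
Local Notation Y := true.

(** * Noncommutative polynomials and the polarized Cayley-Hamilton identity *)

(* Noncommutative polynomials with integer coefficients, as lists of
   (coefficient, word); in a word, [false] stands for x and [true] for y. *)
Notation ncpoly := (seq (int * seq bool)).

Definition nc_mul (f g : ncpoly) : ncpoly :=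
  [seq (t.1 * u.1, t.2 ++ u.2) | t <- f, u <- g].
Definition nc_scale (c : int) (f : ncpoly) : ncpoly :=
  [seq (c * t.1, t.2) | t <- f].
Definition nc_coef (f : ncpoly) (s : seq bool) : int :=
  foldr (fun t c => if t.2 == s then t.1 + c else c) 0 f.
Definition nc_null (f : ncpoly) : bool := all (fun t => nc_coef f t.2 == 0) f.

Section FreeSum.
Variables (V : zmodType) (phi : seq bool -> V).

Definition nc_sum (f : ncpoly) : V := \sum_(t <- f) phi t.2 *~ t.1.

Lemma nc_sum_cat f g : nc_sum (f ++ g) = nc_sum f + nc_sum g.
Proof. exact: big_cat. Qed.

Lemma nc_sum_scale c f : nc_sum (nc_scale c f) = nc_sum f *~ c.
Proof.
rewrite /nc_sum big_map mulrz_suml; apply: eq_bigr => t _ /=.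
by rewrite mulrzA mulrzAC.
Qed.

Lemma nc_sum_coef f (U : seq (seq bool)) :
  uniq U -> all (fun t => t.2 \in U) f ->
  nc_sum f = \sum_(s <- U) phi s *~ nc_coef f s.
Proof.
move=> uU; elim: f => [|t f IH] /=; rewrite /nc_sum ?big_nil ?big_cons.
  by rewrite big1 // => s _; rewrite mulr0z.
case/andP=> tU /IH; rewrite /nc_sum => ->.
rewrite !(bigD1_seq t.2) //= eqxx mulrzDr addrA; congr (_ + _).
by apply: eq_bigr => s /negbTE; rewrite eq_sym => ->.
Qed.

(** Reflection principle: a formal cancellation checked by evaluating [nc_null] becomes an identity
    in every abelian group. *)
Lemma nc_sum_null f : nc_null f -> nc_sum f = 0.
Proof.
move=> /allP f0; rewrite (@nc_sum_coef f (undup [seq t.2 | t <- f])).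
- rewrite big_seq big1 // => s; rewrite mem_undup => /mapP[t tf ->].
  by rewrite (eqP (f0 t tf)) mulr0z.
- exact: undup_uniq.
by apply/allP => t tf; rewrite mem_undup map_f.
Qed.

End FreeSum.

Section Evaluation.
Variables (A : nzRingType) (x y : A).

Definition ev (s : seq bool) : A := \prod_(b <- s) (if b then y else x).

Lemma ev_nil : ev [::] = 1. Proof. exact: big_nil. Qed.
Lemma ev_cons b s : ev (b :: s) = (if b then y else x) * ev s.
Proof. exact: big_cons. Qed.
Lemma ev_cat s t : ev (s ++ t) = ev s * ev t. Proof. exact: big_cat. Qed.
Lemma ev_rcons s b : ev (rcons s b) = ev s * (if b then y else x).
Proof. by rewrite -cats1 ev_cat ev_cons ev_nil mulr1. Qed.

Lemma nc_eval_mul f g : nc_sum ev (nc_mul f g) = nc_sum ev f * nc_sum ev g.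
Proof.
rewrite /nc_sum /nc_mul big_allpairs_dep mulr_suml; apply: eq_bigr => t _.
rewrite mulr_sumr; apply: eq_bigr => u _ /=.
by rewrite ev_cat mulrzAr mulrzAl -mulrzA mulrC.
Qed.

End Evaluation.

Lemma ord3P (P : pred 'I_3) :
  P 0 -> P 1 -> P 2%:R -> forall i, P i.
Proof.
move=> h0 h1 h2 [[|[|[|i]]] hi] //.
- by rewrite (_ : Ordinal _ = 0) //; apply: val_inj.
- by rewrite (_ : Ordinal _ = 1) //; apply: val_inj.
by rewrite (_ : Ordinal _ = 2%:R) //; apply: val_inj.
Qed.

Lemma sum3E (R : nmodType) (F : 'I_3 -> R) : \sum_i F i = F 0 + F 1 + F 2%:R.
Proof.
rewrite !big_ord_recl big_ord0 addr0 addrA; congr (F _ + F _ + F _); exact: val_inj.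
Qed.

Lemma mul3E (R : nzRingType) (a b : 'M[R]_3) i j :
  (a * b) i j = a i 0 * b 0 j + a i 1 * b 1 j + a i 2%:R * b 2%:R j.
Proof. by rewrite mxE sum3E. Qed.

Lemma tr3E (R : nzRingType) (a : 'M[R]_3) : \tr a = a 0 0 + a 1 1 + a 2%:R 2%:R.
Proof. exact: sum3E. Qed.
(** Full linearization of the Cayley-Hamilton cubic; a = b = c gives six times the usual identity.
    It is verified entry by entry as nine polynomial identities in 27 variables. *)
Lemma polarized_CH3 (R : comNzRingType) (a b c : 'M[R]_3) :
  a * b * c + a * c * b + b * a * c + b * c * a + c * a * b + c * b * a =
  \tr a *: (b * c + c * b) + \tr b *: (a * c + c * a) + \tr c *: (a * b + b * a)
  + (\tr (a * b) - \tr a * \tr b) *: c + (\tr (a * c) - \tr a * \tr c) *: b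
  + (\tr (b * c) - \tr b * \tr c) *: a
  + (\tr a * \tr b * \tr c - \tr a * \tr (b * c) - \tr b * \tr (a * c)
     - \tr c * \tr (a * b) + \tr (a * b * c) + \tr (a * c * b))%:M.
Proof.
apply/matrixP => i j.
rewrite !tr3E !(mul3E, mxE).
apply/eqP; move: i; apply: ord3P; move: j; apply: ord3P; apply/eqP => /=;
rewrite ?mulr1n ?mulr0n;
move: (a 0 0) (a 0 1) (a 0 2%:R) (a 1 0) (a 1 1) (a 1 2%:R) (a 2%:R 0) (a 2%:R 1) (a 2%:R 2%:R)
 (b 0 0) (b 0 1) (b 0 2%:R) (b 1 0) (b 1 1) (b 1 2%:R) (b 2%:R 0) (b 2%:R 1) (b 2%:R 2%:R)
 (c 0 0) (c 0 1) (c 0 2%:R) (c 1 0) (c 1 1) (c 1 2%:R) (c 2%:R 0) (c 2%:R 1) (c 2%:R 2%:R) => *.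
all: ring.
Qed.

Definition perms3 (T : Type) (a b c : seq T) : seq (seq T) :=
  [:: a ++ b ++ c; a ++ c ++ b; b ++ a ++ c; b ++ c ++ a; c ++ a ++ b; c ++ b ++ a].

(** When [a], [b], [c] are nonempty, every word outside a trace on the right is shorter than the six
    words on the left; this drives all the reductions. *)
Lemma ev_perms3 (R : comNzRingType) (x y : 'M[R]_3) (l a b c r : seq bool) :
  \sum_(u <- perms3 a b c) ev x y (l ++ u ++ r) =
  \tr (ev x y a) *: (ev x y (l ++ b ++ c ++ r) + ev x y (l ++ c ++ b ++ r))
  + \tr (ev x y b) *: (ev x y (l ++ a ++ c ++ r) + ev x y (l ++ c ++ a ++ r))
  + \tr (ev x y c) *: (ev x y (l ++ a ++ b ++ r) + ev x y (l ++ b ++ a ++ r))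
  + (\tr (ev x y (a ++ b)) - \tr (ev x y a) * \tr (ev x y b)) *: ev x y (l ++ c ++ r)
  + (\tr (ev x y (a ++ c)) - \tr (ev x y a) * \tr (ev x y c)) *: ev x y (l ++ b ++ r)
  + (\tr (ev x y (b ++ c)) - \tr (ev x y b) * \tr (ev x y c)) *: ev x y (l ++ a ++ r)
  + (\tr (ev x y a) * \tr (ev x y b) * \tr (ev x y c) - \tr (ev x y a) * \tr (ev x y (b ++ c))
     - \tr (ev x y b) * \tr (ev x y (a ++ c)) - \tr (ev x y c) * \tr (ev x y (a ++ b))
     + \tr (ev x y (a ++ b ++ c)) + \tr (ev x y (a ++ c ++ b))) *: ev x y (l ++ r).
Proof.
rewrite !big_cons big_nil addr0. rewrite !ev_cat.
move: (ev x y l) (ev x y a) (ev x y b) (ev x y c) (ev x y r) => L A B C D.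
transitivity (L * (A * B * C + A * C * B + B * A * C + B * C * A + C * A * B + C * B * A) * D).
  by rewrite !mulrDr !mulrDl !mulrA -!addrA.
rewrite polarized_CH3 -scalemx1.
have fD (a1 a2 : 'M[R]_3) : L * (a1 + a2) * D = L * a1 * D + L * a2 * D.
  by rewrite mulrDr mulrDl.
have fZ k (a1 : 'M[R]_3) : L * (k *: a1) * D = k *: (L * a1 * D).
  by rewrite -scalerAr -scalerAl.
rewrite !fD !fZ !fD mulr1 !mulrA.
by [].
Qed.

(** * Spanning: traces and reduction of words *)

Section Span.
Variables (R : comNzRingType) (S : R -> Prop) (n : nat).
Hypotheses (S0 : S 0) (S1 : S 1) (SM : forall p q, S p -> S q -> S (p * q)).
Local Notation mx := 'M[R]_n.+1.
Implicit Types V W : mx -> Prop.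

(** Counterpart of [lin_span] over an abstract commutative ring: the reductions use only closure
    properties of the coefficients. *)
Inductive mspan V : mx -> Prop :=
| mspan_zero : mspan V 0
| mspan_add p a b : S p -> V a -> mspan V b -> mspan V (p *: a + b).

Lemma mspan_gen V a : V a -> mspan V a.
Proof. by move=> Va; rewrite -[a]addr0 -[a]scale1r; apply: mspan_add => //; left. Qed.

Lemma mspanD V a b : mspan V a -> mspan V b -> mspan V (a + b).
Proof.
move=> Ha; elim: Ha b => [b|p a' b' Rp Va _ IH b Hb]; first by rewrite add0r.
by rewrite -addrA; apply: mspan_add => //; apply: IH.
Qed.

Lemma mspanZ V p a : S p -> mspan V a -> mspan V (p *: a).
Proof.
move=> Rp; elim=> [|q a' b' Rq Va _ IH]; first by rewrite scaler0; left.
by rewrite scalerDr scalerA; apply: mspan_add => //; apply: SM.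
Qed.

Lemma mspan_sub V W a :
  (forall b, V b -> mspan W b) -> mspan V a -> mspan W a.
Proof.
move=> VW; elim=> [|p a' b' Rp Va _ IH]; first by left.
by apply: mspanD => //; apply: mspanZ => //; apply: VW.
Qed.

Lemma mspan_mulr V W c :
  (forall a, V a -> mspan W (a * c)) -> forall a, mspan V a -> mspan W (a * c).
Proof.
move=> VW a; elim=> [|p a' b' Rp Va _ IH]; first by rewrite mul0r; left.
rewrite mulrDl -scalerAl; apply: mspanD => //; apply: mspanZ => //; exact: VW.
Qed.

Lemma mspan_mull V W c :
  (forall a, V a -> mspan W (c * a)) -> forall a, mspan V a -> mspan W (c * a).
Proof.
move=> VW a; elim=> [|p a' b' Rp Va _ IH]; first by rewrite mulr0; left.
rewrite mulrDr -scalerAr; apply: mspanD => //; apply: mspanZ => //; exact: VW.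
Qed.

Lemma mspan_tr V (Q : R -> Prop) :
  Q 0 -> (forall p q, Q p -> Q q -> Q (p + q)) ->
  (forall p q, S p -> Q q -> Q (p * q)) ->
  (forall a, V a -> Q (\tr a)) -> forall a, mspan V a -> Q (\tr a).
Proof.
move=> Q0 QD QZ VQ a; elim=> [|p a' b' Rp Va _ IH]; first by rewrite raddf0.
by rewrite raddfD /= mxtraceZ; apply: QD => //; apply: QZ => //; apply: VQ.
Qed.

End Span.

(** * Cyclic words in two letters, up to length 6 *)

Fixpoint all_words k : seq (seq bool) :=
  if k is k'.+1 then
    map (cons false) (all_words k') ++ map (cons true) (all_words k')
  else [:: [::]].

Lemma mem_all_words s : s \in all_words (size s).
Proof.
elim: s => //= b s IH; rewrite mem_cat.
by case: b; apply/orP; [right|left]; apply: map_f.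
Qed.

Definition rots (s : seq bool) : seq (seq bool) := [seq rot n s | n <- iota 0 (size s)].

(* Up to cyclic rotation this word and its reversal are the only two words of
   length at most 6 that differ from their reversals; the difference of their
   traces is w, and chirality s is the integer c with tr(s) - tr(rev s) = c w. *)
Definition chiral : seq bool := [:: false; false; true; true; false; true].

Definition chirality (s : seq bool) : int :=
  (s \in rots chiral)%:Z - (s \in rots (rev chiral))%:Z.

Definition starts_cube (s : seq bool) : bool :=
  (take 3 s == nseq 3 false) || (take 3 s == nseq 3 true).

(** From length 3 on, representatives of the cyclic words without three equal consecutive letters. A
    cyclic word with such a cube is reduced at once by the identity with three equal arguments. *)
Definition necklaces k : seq (seq bool) :=
  match k with
  | 0 => [:: [::]]
  | 1 => [:: [:: false]; [:: true]]
  | 2 => [:: [:: false; false]; [:: false; true]; [:: true; true]]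
  | 3 => [:: [:: false; false; true]; [:: true; true; false]]
  | 4 => [:: [:: false; false; true; true]; [:: false; true; false; true]]
  | 5 => [:: [:: false; false; true; false; true]; [:: true; true; false; true; false]]
  | 6 => [:: [:: false; false; true; false; false; true];
             [:: true; true; false; true; true; false];
             [:: false; true; false; true; false; true];
             chiral; rev chiral]
  | _ => [::]
  end.

Lemma necklaceP s : (size s <= 6)%N -> exists n,
  [/\ (rot n s \in necklaces (size s)) || starts_cube (rot n s)
    & chirality (rot n s) = chirality s].
Proof.
have ok : all (fun k => all (fun s => has (fun n =>
    ((rot n s \in necklaces k) || starts_cube (rot n s))
    && (chirality (rot n s) == chirality s)) (iota 0 7)) (all_words k)) (iota 0 7).
  by vm_compute.
move=> le6; have /(allP ok)/allP/(_ _ (mem_all_words s))/hasP : size s \in iota 0 7.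
  by rewrite mem_iota.
by case=> n _ /andP[h /eqP ?]; exists n; split.
Qed.

(** What the reduction of traces uses of S and (x, y). The base field enters only through
    [redS_inv], which lets all certificates have integer coefficients. *)
Record reduced_pair (R : comNzRingType) (S : R -> Prop) (x y : 'M[R]_3) : Prop :=
  ReducedPair {
    redS0 : S 0;
    redS1 : S 1;
    redSD : forall p q, S p -> S q -> S (p + q);
    redSN : forall p, S p -> S (- p);
    redSM : forall p q, S p -> S q -> S (p * q);
    redS_inv : forall z : int, z != 0 -> exists2 c, S c & c *~ z = 1;
    red_trx : \tr x = 0;
    red_try : \tr y = 0;
    redSxx : S (\tr (x * x));
    redSxy : S (\tr (x * y));
    redSyy : S (\tr (y * y));
    redSxxx : S (\tr (x * x * x));
    redSxxy : S (\tr (x * x * y));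
    redSxyy : S (\tr (x * y * y));
    redSyyy : S (\tr (y * y * y));
    redSv : S (\tr (x * x * y * y) - \tr (x * y * x * y)) }.

(** * Traces of words of length at most 6 *)

Section Traces.
Variables (R : comNzRingType) (S : R -> Prop) (x y : 'M[R]_3).
Hypothesis xyS : reduced_pair S x y.
Let S0 := redS0 xyS.
Let S1 := redS1 xyS.
Let SD := redSD xyS.
Let SN := redSN xyS.
Let SM := redSM xyS.
Local Notation t s := (\tr (ev x y s)).
Let w := t chiral - t (rev chiral).

Lemma S_divz p (z : int) : z != 0 -> S (p *~ z) -> S p.
Proof.
move=> /(redS_inv xyS)[c Sc cz] Sp; rewrite -[p]mulr1 -cz mulrzAr -mulrzAl mulrC.
exact: SM.
Qed.

Lemma tr_ev_rot n s : t (rot n s) = t s.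
Proof.
by rewrite /rot ev_cat [LHS]mxtrace_mulC -[_ *m _]/(_ * _) -ev_cat cat_take_drop.
Qed.

Lemma S_sub p q : S p -> S q -> S (p - q).
Proof. by move=> Sp Sq; apply: SD => //; apply: SN. Qed.
Lemma S_mulz p z : S p -> S (p *~ z).
Proof.
have SMn m : S p -> S (p *+ m).
  by move=> Sp; elim: m => // m IH; rewrite mulrS; apply: SD.
by move=> Sp; case: z => m; [apply: SMn | rewrite NegzE mulrNz; apply/SN/SMn].
Qed.
Lemma S_congr p q : S (p - q) -> S q -> S p.
Proof. by move=> Spq Sq; rewrite -(subrK q p); apply: SD. Qed.

Lemma tr_letter b : t [:: b] = 0.
Proof.
by rewrite ev_cons ev_nil mulr1; case: b; [apply: red_try xyS | apply: red_trx xyS].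
Qed.

(* All traces on the right-hand side of the polarized identity, multiplied by a
   word r and traced, are traces of words shorter than the ones on the left. *)
Lemma S_tr_perms3 (k : nat) a b c r :
  (forall s, (size s <= k)%N -> S (t s)) ->
  (0 < size a)%N -> (0 < size b)%N -> (0 < size c)%N -> (0 < size r)%N ->
  (size a + size b + size c + size r <= k.+1)%N ->
  S (\sum_(u <- perms3 a b c) t (u ++ r)).
Proof.
move=> IH a0 b0 c0 r0 le_k.
rewrite (_ : \sum_(u <- _) _ = \tr (\sum_(u <- perms3 a b c) ev x y ([::] ++ u ++ r))); last first.
  by rewrite raddf_sum.
rewrite ev_perms3 !mxtraceD !mxtraceZ !mxtraceD.
have T s : (size s <= k)%N -> S (t s) by exact: IH.
repeat (first [apply: SD | apply: S_sub | apply: SM | apply: T | apply: SN]);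
by rewrite ?size_cat /=; lia.
Qed.

(** With three equal arguments the six terms of the polarized identity coincide, so six times this
    trace is a combination of products of shorter ones. *)
Lemma S_tr_cube k b d :
  (forall s, (size s <= k)%N -> S (t s)) -> (0 < size d)%N ->
  (size d + 3 <= k.+1)%N -> S (t (nseq 3 b ++ d)).
Proof.
move=> IH d0 le_k; apply: (@S_divz _ 6) => //.
have := @S_tr_perms3 k [:: b] [:: b] [:: b] d IH isT isT isT d0.
rewrite !big_cons big_nil /= => H; apply: (S_congr _ (H _)); last by lia.
by rewrite [X in S X](_ : _ = 0) //; ring.
Qed.

Lemma S_tr_step k : (2 < k < 6)%N -> (forall s, (size s <= k)%N -> S (t s)) ->
  (forall s, s \in necklaces k.+1 -> S (t s)) ->
  forall s, (size s <= k.+1)%N -> S (t s).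
Proof.
case/andP=> k2 k6 IH N s; rewrite leq_eqVlt => /orP[/eqP sk|]; last exact: IH.
have s6 : (size s <= 6)%N by rewrite sk.
have [n [/orP[h|h] _]] := necklaceP s6; rewrite -(tr_ev_rot n).
  by apply: N; rewrite -sk.
have hs : size (rot n s) = k.+1 by rewrite size_rot.
rewrite -(cat_take_drop 3 (rot n s)); case/orP: h => /eqP ->; apply: (@S_tr_cube k) => //;
rewrite size_drop hs; lia.
Qed.

Lemma S_tr3 s : (size s <= 3)%N -> S (t s).
Proof.
case: s => [|a [|b [|c [|//]]]] _.
- by rewrite ev_nil mxtrace1; exact: (S_mulz 3 S1).
- by rewrite tr_letter.
- have tE b1 b2 : ev x y [:: b1; b2] = (if b1 then y else x) * (if b2 then y else x).
    by rewrite !ev_cons ev_nil mulr1.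
  case: a; case: b; rewrite -?[t [:: Y; X]](tr_ev_rot 1) tE;
  by [exact: redSxx xyS | exact: redSxy xyS | exact: redSyy xyS].
have tE b1 b2 b3 : ev x y [:: b1; b2; b3] =
    (if b1 then y else x) * (if b2 then y else x) * (if b3 then y else x).
  by rewrite !ev_cons ev_nil mulr1 mulrA.
case: a; case: b; case: c; rewrite -?[t [:: Y; X; X]](tr_ev_rot 1)
   -?[t [:: X; Y; X]](tr_ev_rot 2) -?[t [:: Y; X; Y]](tr_ev_rot 1)
   -?[t [:: Y; Y; X]](tr_ev_rot 2) tE;
by [exact: redSxxx xyS | exact: redSxxy xyS | exact: redSxyy xyS | exact: redSyyy xyS].
Qed.

(** The identity leaves one relation, 4 t(xxyy) + 2 t(xyxy) in S, between two unknown traces. The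
    generator v = t(xxyy) - t(xyxy) is the missing second one: adding 2v gives 6 t(xxyy). *)
Lemma S_tr4 s : (size s <= 4)%N -> S (t s).
Proof.
apply: S_tr_step => //; first exact: S_tr3.
have := @S_tr_perms3 3 [:: X] [:: X] [:: Y] [:: Y] S_tr3 isT isT isT isT isT.
rewrite !big_cons big_nil /= (_ : t [:: Y; X; X; Y] = t [:: X; X; Y; Y]); last first.
  by rewrite -[RHS](tr_ev_rot 3).
move=> H; have Sv : S (t [:: X; X; Y; Y] - t [:: X; Y; X; Y]).
  by have := redSv xyS; rewrite !ev_cons ev_nil mulr1 !mulrA.
have S2 : S (t [:: X; X; Y; Y]).
  apply: (@S_divz _ 6) => //; apply: (S_congr _ H).
  rewrite [X in S X](_ : _ = (t [:: X; X; Y; Y] - t [:: X; Y; X; Y]) *~ 2); last by ring.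
  exact: S_mulz.
move=> u; rewrite !inE => /orP[/eqP-> //|/eqP->].
rewrite -[t _](subKr (t [:: X; X; Y; Y])); exact: S_sub.
Qed.

Lemma S_tr5 s : (size s <= 5)%N -> S (t s).
Proof.
apply: S_tr_step => //; first exact: S_tr4.
have cube (b c : bool) : S (t [:: b; b; b; c; c]).
  by apply: (@S_tr_cube 4 b [:: c; c]) => //; exact: S_tr4.
(* The identity for b, b, c multiplied by cb gives 2 t(bbbcc) + 4 t(bbcbc), and the first trace
   contains a cube. Hence no new generator appears in degree 5. *)
have aux (b c : bool) : S (t [:: b; b; c; b; c]).
  have := @S_tr_perms3 4 [:: b] [:: b] [:: c] [:: c; b] S_tr4 isT isT isT isT isT.
  rewrite !big_cons big_nil /=.
  rewrite (_ : t [:: b; b; c; c; b] = t [:: b; b; b; c; c]); last by rewrite -[RHS](tr_ev_rot 1).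
  rewrite (_ : t [:: b; c; b; c; b] = t [:: b; b; c; b; c]); last by rewrite -[RHS](tr_ev_rot 1).
  rewrite (_ : t [:: c; b; b; c; b] = t [:: b; b; c; b; c]); last by rewrite -[RHS](tr_ev_rot 4).
  move=> H; apply: (@S_divz _ 4) => //; apply: (S_congr _ H).
  rewrite [X in S X](_ : _ = t [:: b; b; b; c; c] *~ - 2); last by ring.
  exact: S_mulz.
by move=> u; rewrite !inE => /orP[/eqP->|/eqP->]; exact: aux.
Qed.

(** The sum of the two chiral traces is in S and their difference is w, so twice either trace is
    plus or minus w modulo S. All other traces of length 6 are in S. *)
Lemma S_tr6 s : (size s <= 6)%N -> S (t s *~ 2 - w *~ chirality s).
Proof.
rewrite leq_eqVlt => /orP[/eqP sk|s5]; last first.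
  have -> : chirality s = 0.
    have ok : all (fun k => all (fun s => chirality s == 0) (all_words k)) (iota 0 6).
      by vm_compute.
    by apply/eqP/(allP (allP ok (size s) _)); rewrite ?mem_iota // mem_all_words.
  by rewrite mulr0z subr0; apply/S_mulz/S_tr5.
have cube (b : bool) (d : seq bool) : size d = 3 -> S (t (nseq 3 b ++ d)).
  by move=> sd; apply: (@S_tr_cube 5) => //; rewrite ?sd //; exact: S_tr5.
have P3 b c r : size r = 3 -> S (\sum_(u <- perms3 [:: b] [:: b] [:: c]) t (u ++ r)).
  by move=> sr; apply: (@S_tr_perms3 5) => //; rewrite ?sr //; exact: S_tr5.
have [n [h eqc]] := necklaceP (eq_leq sk); rewrite -(tr_ev_rot n) -eqc.
move: h; set u := rot n s; have su : size u = 6 by rewrite size_rot.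
(* The identity for x, x, y multiplied by yyx: its cyclic words are xxxyyy, which contains a cube,
   and the two chiral ones, each twice. *)
have Ssum : S (t chiral + t (rev chiral)).
  have := P3 X Y [:: Y; Y; X] erefl; rewrite !big_cons big_nil /=.
  rewrite (_ : t [:: X; X; Y; Y; Y; X] = t [:: X; X; X; Y; Y; Y]); last by rewrite -[RHS](tr_ev_rot 1).
  rewrite (_ : t [:: X; Y; X; Y; Y; X] = t (rev chiral)); last by rewrite -[RHS](tr_ev_rot 5).
  rewrite (_ : t [:: Y; X; X; Y; Y; X] = t chiral); last by rewrite -[RHS](tr_ev_rot 5).
  move=> H; apply: (@S_divz _ 2) => //; apply: (S_congr _ H).
  rewrite [X in S X](_ : _ = t [:: X; X; X; Y; Y; Y] *~ - 2); last by ring.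
  by apply/S_mulz/(cube X [:: Y; Y; Y]).
have dbl (b c : bool) : S (t [:: b; b; c; b; b; c]).
  have := P3 b c [:: b; b; c] erefl; rewrite !big_cons big_nil /=.
  rewrite (_ : t [:: b; c; b; b; b; c] = t [:: b; b; b; c; b; c]); last by rewrite -[RHS](tr_ev_rot 4).
  rewrite (_ : t [:: c; b; b; b; b; c] = t [:: b; b; b; b; c; c]); last by rewrite -[RHS](tr_ev_rot 5).
  move=> H; apply: (@S_divz _ 2) => //; apply: (S_congr _ H).
  rewrite [X in S X](_ : _ = (t [:: b; b; b; c; b; c] + t [:: b; b; b; b; c; c]) *~ - 2); last by ring.
  by apply/S_mulz/SD; apply: (cube b).
case/orP=> [|h].
  rewrite sk !inE => /or4P[/eqP->|/eqP->|/eqP->|/orP[]/eqP->].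
  - by rewrite [chirality _](_ : _ = 0) // mulr0z subr0; apply: S_mulz.
  - by rewrite [chirality _](_ : _ = 0) // mulr0z subr0; apply: S_mulz.
  - rewrite [chirality _](_ : _ = 0) // mulr0z subr0.
    have := P3 X Y [:: Y; X; Y] erefl; rewrite !big_cons big_nil /=.
    rewrite (_ : t [:: X; X; Y; Y; X; Y] = t chiral) //.
    rewrite (_ : t [:: Y; X; X; Y; X; Y] = t (rev chiral)); last by rewrite -[RHS](tr_ev_rot 3).
    move=> H; apply: (S_congr _ H).
    rewrite [X in S X](_ : _ = (t chiral + t (rev chiral)) *~ - 2); last by ring.
    exact: S_mulz.
  - rewrite [chirality _](_ : _ = 1) // mulr1z.
    by rewrite [X in S X](_ : _ = t chiral + t (rev chiral)) // /w; ring.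
  rewrite [chirality _](_ : _ = -1) // mulrN1z.
  by rewrite [X in S X](_ : _ = t chiral + t (rev chiral)) // /w; ring.
have -> : chirality u = 0.
  have ok : all (fun s => starts_cube s ==> (chirality s == 0)) (all_words 6) by vm_compute.
  by have := mem_all_words u; rewrite su => /(allP ok)/implyP/(_ h)/eqP.
rewrite mulr0z subr0; apply: S_mulz; rewrite -(cat_take_drop 3 u).
by case/orP: h => /eqP ->; apply: cube; rewrite size_drop su.
Qed.

End Traces.

(* The i-th summand of G is det^(det_rank i) (x) Sym^(sym_rank i), of degree
   fam_deg i; the j-th element of its basis is op_nc i applied to the j-th
   element of the basis x^2, xy + yx, y^2 (or x, y, or 1) of Sym. *)
Definition sym_rank (i : nat) : nat := nth 0 [:: 0; 1; 2; 0; 1; 1; 2; 0; 1] i.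
Definition fam_deg (i : nat) : nat := nth 0 [:: 0; 1; 2; 2; 3; 3; 4; 4; 5] i.

Definition sym_nc (m j : nat) : ncpoly :=
  match m, j with
  | 0, _ => [:: (1, [::])]
  | 1, 0 => [:: (1, [:: false])]
  | 1, _ => [:: (1, [:: true])]
  | _, 0 => [:: (1, [:: false; false])]
  | _, 1 => [:: (1, [:: false; true]); (1, [:: true; false])]
  | _, _ => [:: (1, [:: true; true])]
  end.

Definition comm_nc : ncpoly := [:: (1, [:: false; true]); (-1, [:: true; false])].

(** Every operation is linear in f and involves x and y otherwise only through [x, y], which g
    multiplies by det g; so each commutes with g up to a power of det g. Case 5 applied to x is
    [x^2, y]. *)
Definition op_nc (i : nat) (f : ncpoly) : ncpoly :=
  match i with
  | 0 | 1 | 2 => f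
  | 3 | 4 | 6 => nc_mul comm_nc f
  | 5 => nc_mul f comm_nc ++ nc_mul comm_nc f
  | _ => nc_mul (nc_mul comm_nc comm_nc) f
  end.

Definition fam_nc (i j : nat) : ncpoly := op_nc i (sym_nc (sym_rank i) j).

Definition fam_index (i j : nat) : bool := (i < 9)%N && (j <= sym_rank i)%N.

(* Certificates, found by linear algebra over the rationals: a row
   ((i, j), b, d, ks, cs) asserts that d times the product of the (i, j)-th
   element and the letter b is the sum of the integer combination ks of elements
   of the family and of the combination cs of l * (sum over perms3 a b c) * r. *)
Definition reductions : seq ((nat * nat) * bool * int * seq (int * (nat * nat)) *
    seq (int * (seq bool * seq bool * seq bool * seq bool * seq bool))) :=
[::
  ((0, 0)%N, X, 1, [:: (1, (1, 0)%N)], [::]);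
  ((0, 0)%N, Y, 1, [:: (1, (1, 1)%N)], [::]);
  ((1, 0)%N, X, 1, [:: (1, (2, 0)%N)], [::]);
  ((1, 0)%N, Y, 2, [:: (1, (3, 0)%N); (1, (2, 1)%N)], [::]);
  ((1, 1)%N, X, 2, [:: (1, (2, 1)%N); (-1, (3, 0)%N)], [::]);
  ((1, 1)%N, Y, 1, [:: (1, (2, 2)%N)], [::]);
  ((2, 0)%N, X, 6, [::],
   [:: (1, ([::], [:: X], [:: X], [:: X], [::]))]);
  ((2, 0)%N, Y, 6, [:: (-2, (4, 0)%N); (4, (5, 0)%N)],
   [:: (1, ([::], [:: X], [:: X], [:: Y], [::]))]);
  ((2, 1)%N, X, 3, [:: (1, (4, 0)%N); (-2, (5, 0)%N)],
   [:: (1, ([::], [:: X], [:: X], [:: Y], [::]))]);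
  ((2, 1)%N, Y, 3, [:: (-1, (4, 1)%N); (2, (5, 1)%N)],
   [:: (1, ([::], [:: X], [:: Y], [:: Y], [::]))]);
  ((2, 2)%N, X, 6, [:: (-4, (5, 1)%N); (2, (4, 1)%N)],
   [:: (1, ([::], [:: X], [:: Y], [:: Y], [::]))]);
  ((2, 2)%N, Y, 6, [::],
   [:: (1, ([::], [:: Y], [:: Y], [:: Y], [::]))]);
  ((3, 0)%N, X, 1, [:: (1, (4, 0)%N)], [::]);
  ((3, 0)%N, Y, 1, [:: (1, (4, 1)%N)], [::]);
  ((4, 0)%N, X, 1, [:: (1, (6, 0)%N)], [::]);
  ((4, 0)%N, Y, 2, [:: (1, (7, 0)%N); (1, (6, 1)%N)], [::]);
  ((4, 1)%N, X, 2, [:: (1, (6, 1)%N); (-1, (7, 0)%N)], [::]);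
  ((4, 1)%N, Y, 1, [:: (1, (6, 2)%N)], [::]);
  ((5, 0)%N, X, 2, [:: (-2, (6, 0)%N)],
   [::
     (-1, ([:: Y], [:: X], [:: X], [:: X], [::]));
     (1, ([::], [:: X], [:: X], [:: Y; X], [::]))]);
  ((5, 0)%N, Y, 2, [:: (1, (7, 0)%N); (-1, (6, 1)%N)],
   [::
     (-2, ([::], [:: X], [:: X; Y], [:: Y], [::]));
     (2, ([:: X], [:: X], [:: Y], [:: Y], [::]))]);
  ((5, 1)%N, X, 2, [:: (-1, (6, 1)%N); (-1, (7, 0)%N)],
   [::
     (-2, ([:: Y], [:: X], [:: X], [:: Y], [::]));
     (2, ([::], [:: X], [:: Y], [:: Y; X], [::]))]);
  ((5, 1)%N, Y, 2, [:: (-2, (6, 2)%N)],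
   [::
     (-1, ([::], [:: X], [:: Y], [:: Y], [:: Y]));
     (1, ([:: X], [:: Y], [:: Y], [:: Y], [::]))]);
  ((6, 0)%N, X, 6, [::],
   [::
     (1, ([:: X; Y], [:: X], [:: X], [:: X], [::]));
     (-1, ([:: Y], [:: X], [:: X], [:: X], [:: X]))]);
  ((6, 0)%N, Y, 6, [:: (2, (8, 0)%N)],
   [::
     (-4, ([::], [:: X], [:: X; X], [:: Y], [:: Y]));
     (3, ([::], [:: X], [:: X], [:: X; Y], [:: Y]));
     (2, ([::], [:: X; X], [:: X; Y], [:: Y], [::]));
     (-3, ([::], [:: X], [:: X], [:: Y; X; Y], [::]));
     (2, ([::], [:: X], [:: X; Y; X], [:: Y], [::]))]);
  ((6, 1)%N, X, 3, [:: (-1, (8, 0)%N)],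
   [::
     (-1, ([::], [:: X], [:: Y], [:: Y], [:: X; X]));
     (1, ([:: Y; Y], [:: X], [:: X], [:: X], [::]));
     (2, ([:: X], [:: X], [:: Y], [:: Y], [:: X]));
     (-2, ([::], [:: X; X], [:: Y], [:: Y], [:: X]))]);
  ((6, 1)%N, Y, 3, [:: (1, (8, 1)%N)],
   [::
     (-2, ([::], [:: X; Y], [:: X; Y], [:: Y], [::]));
     (4, ([:: X], [:: X; Y], [:: Y], [:: Y], [::]));
     (-1, ([::], [:: X], [:: X], [:: Y], [:: Y; Y]));
     (-1, ([:: X; X], [:: Y], [:: Y], [:: Y], [::]))]);
  ((6, 2)%N, X, 6, [:: (-2, (8, 1)%N)],
   [::
     (-1, ([:: Y; X], [:: X], [:: Y], [:: Y], [::]));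
     (-2, ([::], [:: X], [:: Y], [:: Y], [:: Y; X]));
     (2, ([::], [:: X; Y; X], [:: Y], [:: Y], [::]));
     (-1, ([:: X; Y], [:: X], [:: Y], [:: Y], [::]));
     (2, ([:: X], [:: Y], [:: Y], [:: Y], [:: X]))]);
  ((6, 2)%N, Y, 6, [::],
   [::
     (-1, ([:: Y; X], [:: Y], [:: Y], [:: Y], [::]));
     (1, ([:: X], [:: Y], [:: Y], [:: Y], [:: Y]))]);
  ((7, 0)%N, X, 1, [:: (1, (8, 0)%N)], [::]);
  ((7, 0)%N, Y, 1, [:: (1, (8, 1)%N)], [::]);
  ((8, 0)%N, X, 2, [::],
   [::
     (-2, ([::], [:: X], [:: X], [:: Y], [:: Y; X; X]));
     (-1, ([:: X; Y; Y], [:: X], [:: X], [:: X], [::]));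
     (1, ([:: X], [:: X], [:: Y], [:: Y], [:: X; X]));
     (2, ([::], [:: X], [:: X; Y], [:: Y], [:: X; X]))]);
  ((8, 0)%N, Y, 2, [::],
   [::
     (-1, ([::], [:: X], [:: X], [:: Y], [:: Y; X; Y]));
     (-1, ([:: X; Y; Y], [:: X], [:: X], [:: Y], [::]));
     (1, ([:: X; Y], [:: X], [:: Y], [:: Y], [:: X]));
     (2, ([::], [:: X], [:: X; Y], [:: Y], [:: X; Y]));
     (-1, ([::], [:: X; Y], [:: X; Y], [:: Y; X], [::]))]);
  ((8, 1)%N, X, 2, [::],
   [::
     (1, ([:: Y], [:: X], [:: X; Y], [:: X; Y], [::]));
     (-1, ([::], [:: X; Y], [:: Y; X], [:: Y; X], [::]));
     (-1, ([:: Y], [:: X], [:: X], [:: Y; X; Y], [::]));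
     (1, ([::], [:: X; Y; X], [:: Y], [:: Y], [:: X]))]);
  ((8, 1)%N, Y, 2, [::],
   [::
     (1, ([::], [:: X; Y], [:: X; Y], [:: Y], [:: Y]));
     (-1, ([:: Y; X; X], [:: Y], [:: Y], [:: Y], [::]));
     (-2, ([::], [:: X], [:: X], [:: Y; Y], [:: Y; Y]));
     (2, ([::], [:: X; X], [:: Y], [:: Y], [:: Y; Y]))])].

(** Besides the formal identity, homogeneity is checked: it guarantees that the trace terms left out
    of the certificate involve only words shorter than the product being reduced. *)
Definition reduction_ok row : bool :=
  let: (ij, b, d, ks, cs) := row in
  let k := (fam_deg ij.1).+1 in
  [&& d != 0,
      all (fun e => fam_index e.2.1 e.2.2 && (fam_deg e.2.1 == k)) ks,
      all (fun e => let: (l, a, b, c, r) := e.2 in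
        [&& (0 < size a)%N, (0 < size b)%N, (0 < size c)%N
          & size l + (size a + (size b + (size c + size r))) == k]%N) cs
    & nc_null (nc_scale (- d) (nc_mul (fam_nc ij.1 ij.2) [:: (1, [:: b])])
        ++ flatten [seq nc_scale e.1 (fam_nc e.2.1 e.2.2) | e <- ks]
        ++ flatten [seq (let: (l, a, b, c, r) := e.2 in
             [seq (e.1, l ++ u ++ r) | u <- perms3 a b c]) | e <- cs])].

Lemma reductions_ok : all reduction_ok reductions.
Proof. by vm_compute. Qed.

Lemma reductionP i j b : fam_index i j ->
  exists d ks cs, ((i, j), b, d, ks, cs) \in reductions.
Proof.
have ok : all (fun i => all (fun j => all (fun b => has (fun row =>
    let: (ij, b', _, _, _) := row in (ij == (i, j)) && (b' == b)) reductions)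
    [:: X; Y]) (iota 0 (sym_rank i).+1)) (iota 0 9) by vm_compute.
case/andP=> i9 jm.
have /hasP[[[[[ij b'] d] ks] cs] row /andP[/eqP eij /eqP eb]] :
   has (fun row => let: (ij, b', _, _, _) := row in (ij == (i, j)) && (b' == b)) reductions.
  have i_iota : i \in iota 0 9 by rewrite mem_iota.
  have /allP bok := allP ok i i_iota.
  by apply: (allP (bok j _)); [rewrite mem_iota | case: b].
by exists d, ks, cs; rewrite -eij -eb.
Qed.

(** * Closure of the span of the family and w under multiplication *)

Section Spanning.
Variables (R : comNzRingType) (S : R -> Prop) (x y : 'M[R]_3).
Hypothesis xyS : reduced_pair S x y.
Let S0 := redS0 xyS.
Let S1 := redS1 xyS.
Let SD := redSD xyS.
Let SN := redSN xyS.
Let SM := redSM xyS.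
Local Notation t s := (\tr (ev x y s)).
Local Notation evx := (ev x y).
Local Notation letter b := (if b then y else x).
Local Notation w := (t chiral - t (rev chiral)).
Hypothesis w_free : forall p q, S p -> S q -> p + q * w = 0 -> q = 0.

Definition fam_mx (i j : nat) : 'M[R]_3 := nc_sum evx (fam_nc i j).

(** Generators of a degree filtration. Since w e enters only at level 6, [M 5] is spanned by the 17
    family elements, whose traces are in S. *)
Definition fam_upto (k : nat) (b : 'M[R]_3) : Prop :=
  (exists i j, [/\ fam_index i j, (fam_deg i <= k)%N & b = fam_mx i j])
  \/ (6 <= k)%N /\ b = w%:M.

Local Notation M k := (mspan S (fam_upto k)).

Lemma fspan0 k : M k 0. Proof. by left. Qed.
Lemma fspanD k a b : M k a -> M k b -> M k (a + b).
Proof. exact: mspanD. Qed.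
Lemma fspanZ k p a : S p -> M k a -> M k (p *: a).
Proof. exact: mspanZ. Qed.
Lemma fspanMz k a z : M k a -> M k (a *~ z).
Proof.
move=> Ma; rewrite -(scale1r a) scalerMzl; apply: fspanZ => //; exact: (S_mulz xyS).
Qed.
Lemma fspanN k a : M k a -> M k (- a).
Proof. by move=> Ma; rewrite -mulrN1z; apply: fspanMz. Qed.
Lemma fspanB k a b : M k a -> M k b -> M k (a - b).
Proof. by move=> Ma Mb; apply: fspanD => //; apply: fspanN. Qed.
Lemma fspan_divz k a (z : int) : z != 0 -> M k (a *~ z) -> M k a.
Proof.
move=> /(redS_inv xyS)[c Sc cz] Ma; rewrite -[a]scale1r -cz -scalerMzl scalerMzr.
exact: fspanZ.
Qed.
Lemma fspan_mono k k' a : (k <= k')%N -> M k a -> M k' a.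
Proof.
move=> kk'; apply: (mspan_sub SM) => b; case=> [[i [j [ij ik ->]]]|[k6 ->]]; apply: (mspan_gen S1).
  by left; exists i, j; split=> //; apply: leq_trans kk'.
by right; split=> //; apply: leq_trans kk'.
Qed.
Lemma fspan_fam k i j : fam_index i j -> (fam_deg i <= k)%N -> M k (fam_mx i j).
Proof. by move=> ij ik; apply: (mspan_gen S1); left; exists i, j. Qed.
Lemma fspan6_w : M 6 w%:M.
Proof. by apply: (mspan_gen S1); right. Qed.
Lemma fspan6_S p : S p -> M 6 p%:M.
Proof.
move=> Sp; rewrite -scalemx1; apply: fspanZ => //.
have := @fspan_fam 6 0 0 isT isT; rewrite /fam_mx /nc_sum big_seq1 ev_nil; exact.
Qed.

Definition SSw p : Prop := exists q r, [/\ S q, S r & p = q + r * w].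

Lemma SSw_S p : S p -> SSw p.
Proof. by move=> Sp; exists p, 0; rewrite mul0r addr0. Qed.
Lemma SSwD p q : SSw p -> SSw q -> SSw (p + q).
Proof.
case=> [p1 [p2 [? ? ->]]] [q1 [q2 [? ? ->]]]; exists (p1 + q1), (p2 + q2).
by split; rewrite ?mulrDl 1?addrACA //; apply: SD.
Qed.
Lemma SSwZ p q : S p -> SSw q -> SSw (p * q).
Proof.
by move=> ? [q1 [q2 [? ? ->]]]; exists (p * q1), (p * q2); rewrite mulrDr mulrA; split=> //; apply: SM.
Qed.
Lemma SSw_divz p (z : int) : z != 0 -> SSw (p *~ z) -> SSw p.
Proof.
move=> /(redS_inv xyS)[c Sc cz] Hp; rewrite -[p]mulr1 -cz mulrzAr -mulrzAl mulrC.
exact: SSwZ.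
Qed.
Lemma fspan6_SSw p : SSw p -> M 6 p%:M.
Proof.
case=> q [r [Sq Sr ->]]; rewrite raddfD /= scalar_mxM; apply: fspanD; first exact: fspan6_S.
rewrite -[_ *m _]/(_ * _) -[r%:M]scalemx1 -scalerAl mul1r; apply: fspanZ => //; exact: fspan6_w.
Qed.

Lemma SSw_tr6 s : (size s <= 6)%N -> SSw (t s).
Proof.
move=> s6; apply: (@SSw_divz _ 2) => //; exists (t s *~ 2 - w *~ chirality s), (1 *~ chirality s).
split; [exact: (S_tr6 xyS) | exact: (S_mulz xyS) |].
by rewrite mulrzl subrK.
Qed.

Definition words_upto k : Prop := forall s, (size s <= k)%N -> M (size s) (evx s).

Lemma fspan_perms3 k l a b c r : (k < 6)%N -> words_upto k ->
  (0 < size a)%N -> (0 < size b)%N -> (0 < size c)%N ->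
  (size l + (size a + (size b + (size c + size r))) == k.+1)%N ->
  M k.+1 (\sum_(u <- perms3 a b c) evx (l ++ u ++ r)).
Proof.
move=> k6 Wk a0 b0 c0 /eqP sz.
have Mw u : (size u <= k)%N -> M k.+1 (evx u).
  by move=> uk; apply: fspan_mono (Wk u uk); lia.
have St s : (size s <= 5)%N -> S (t s) by exact: (S_tr5 xyS).
(* A trace of length 6 can occur only for k = 5, as the coefficient of the empty word; it then
   contributes an element of S e + S w e, which [M 6] contains. *)
have M_tr s u : (0 < size s)%N -> (size s + size u <= k.+1)%N -> M k.+1 (t s *: evx u).
  move=> s0 su; have [s5|s6] := leqP (size s) 5.
    by apply: fspanZ; [apply: St | apply: Mw; lia].
  have -> : u = [::] by apply: size0nil; lia.
  have -> : k = 5 by lia.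
  by rewrite ev_nil scalemx1; apply/fspan6_SSw/SSw_tr6; lia.
rewrite ev_perms3 !scalerDl !scalerDr !scaleNr -!scalerA.
repeat (first [apply: fspanD | apply: fspanN]); rewrite -?scalerDr;
repeat (first [apply: M_tr | apply: fspanZ; first by apply: St; lia]);
by rewrite ?size_cat; lia.
Qed.

(** In degree 6 the certificates contain no family elements; w e then enters solely through the
    traces of length 6 in [fspan_perms3]. *)
Lemma fam_step i j b k : fam_index i j -> (fam_deg i <= k)%N -> (k < 6)%N ->
  words_upto k -> M (fam_deg i).+1 (fam_mx i j * letter b).
Proof.
move=> ij ik k6 Wk; set d0 := fam_deg i in ik *.
have [d [ks [cs row]]] := reductionP b ij.
have /=/and4P[d_neq0 /allP ksP /allP csP nul] := allP reductions_ok _ row.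
have /= := nc_sum_null evx nul.
rewrite !nc_sum_cat nc_sum_scale nc_eval_mul /= mulrNz => H.
have -> : fam_mx i j * letter b = nc_sum evx (fam_nc i j) * nc_sum evx [:: (1, [:: b])].
  by rewrite [X in _ = _ * X]/nc_sum big_seq1 ev_cons ev_nil mulr1.
apply: (fspan_divz d_neq0); move/eqP: H; rewrite addrC subr_eq0 => /eqP <-; apply: fspanD.
  elim: ks ksP {row nul} => [|e ks IH] ksP /=; first by rewrite /nc_sum big_nil; apply: fspan0.
  rewrite nc_sum_cat nc_sum_scale; apply: fspanD; last first.
    by apply: IH => f fks; apply: ksP; rewrite inE fks orbT.
  have /andP[eij /eqP edeg] := ksP e (mem_head _ _).
  by apply/fspanMz/fspan_fam => //; rewrite edeg.
elim: cs csP {row nul} => [|[c [[[[l a] b'] c'] r]] cs IH] csP /=.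
  by rewrite /nc_sum big_nil; apply: fspan0.
rewrite (_ : [:: _, _, _, _, _, _ & _] =
   nc_scale c [seq (1, l ++ u ++ r) | u <- perms3 a b' c'] ++ 
   flatten [seq (let: (l, a, b, c, r) := e.2 in
             [seq (e.1, l ++ u ++ r) | u <- perms3 a b c]) | e <- cs]); last by rewrite /= !mulr1.
rewrite nc_sum_cat nc_sum_scale; apply: fspanD; last first.
  by apply: IH => f fcs; apply: csP; rewrite inE fcs orbT.
apply: fspanMz; rewrite /nc_sum big_map.
have /and4P[a0 b0 c0 sz] := csP _ (mem_head _ _).
rewrite (eq_bigr (fun u => evx (l ++ u ++ r))) => [|u _]; last by rewrite mulr1z.
apply: (fspan_perms3 _ _ a0 b0 c0 sz) => [|s sk]; first exact: leq_ltn_trans ik k6.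
by apply: Wk; apply: leq_trans sk ik.
Qed.

Lemma words_upto_fspan k : (k <= 6)%N -> words_upto k.
Proof.
elim: k => [|k IH] k6 s; rewrite leq_eqVlt => /orP[/eqP sk|]; rewrite ?ltn0 //.
- rewrite (size0nil sk) ev_nil; apply: fspan_mono (leq0n _) _.
  have := @fspan_fam 0 0 0 isT isT; rewrite /fam_mx /nc_sum big_seq1 ev_nil; exact.
- have {}IH := IH (ltnW k6); case: s sk => // b0 s0; rewrite [_ :: _]lastI.
  set s := belast _ _; set b := last _ _; rewrite size_rcons => -[sk]; rewrite sk ev_rcons.
  have Ms : M k (evx s) by rewrite -sk; apply: IH; rewrite sk.
  apply: (mspan_mulr SM _ Ms) => a [[i [j [ij ik ->]]]|[k6' _]]; last by lia.
  by apply: fspan_mono (fam_step b ij ik k6 IH).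
by move=> sk; apply: IH => //; apply: ltnW.
Qed.

Lemma fspan_word k s : (size s <= k)%N -> (k <= 6)%N -> M k (evx s).
Proof. by move=> sk k6; apply: (fspan_mono sk); apply: (@words_upto_fspan k). Qed.

Lemma fam_homog i j : fam_index i j ->
  all (fun e => size e.2 == fam_deg i) (fam_nc i j).
Proof.
have ok : all (fun i => all (fun j => all (fun e => size e.2 == fam_deg i) (fam_nc i j))
    (iota 0 (sym_rank i).+1)) (iota 0 9) by vm_compute.
case/andP=> i9 jm.
have i_iota : i \in iota 0 9 by rewrite mem_iota.
by have /allP := allP ok i i_iota; apply; rewrite mem_iota.
Qed.

Lemma fam_deg5 i : (fam_deg i <= 5)%N.
Proof.
by rewrite /fam_deg; do 9? [case: i => [//|i]]; rewrite nth_default.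
Qed.

Lemma S_tr_fam i j : fam_index i j -> S (\tr (fam_mx i j)).
Proof.
move=> ij; rewrite /fam_mx /nc_sum raddf_sum /= big_seq.
elim/big_ind: _ => // e eij; rewrite raddfMz; apply: (S_mulz xyS); apply: (S_tr5 xyS).
by rewrite (eqP (allP (fam_homog ij) _ eij)) fam_deg5.
Qed.

Lemma S_tr_fspan5 a : M 5 a -> S (\tr a).
Proof. by apply: mspan_tr => // b [[i [j [ij _ ->]]]|[]//]; apply: S_tr_fam. Qed.

Lemma SSw_tr_fspan6 a : M 6 a -> SSw (\tr a).
Proof.
apply: mspan_tr => [|||b [[i [j [ij _ ->]]]|[_ ->]]].
- exact: SSw_S.
- exact: SSwD.
- exact: SSwZ.
- by apply/SSw_S/S_tr_fam.
exists 0, (1 *+ 3); split=> //; first exact: (S_mulz xyS 3 S1).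
by rewrite mxtrace_scalar mulr_natl add0r.
Qed.

Lemma fspan6_split a : M 6 a -> exists m q, [/\ M 5 m, S q & a = m + (q * w)%:M].
Proof.
elim=> [|p a' b' Sp Va _ [m [q [Mm Sq ->]]]].
  by exists 0, 0; split=> //; [apply: fspan0 | rewrite mul0r raddf0 addr0].
case: Va => [[i [j [ij _ ->]]]|[_ ->]].
  exists (p *: fam_mx i j + m), q; rewrite addrA; split=> //.
  by apply: fspanD => //; apply: fspanZ => //; apply: fspan_fam => //; apply: fam_deg5.
exists m, (p + q); split=> //; first exact: SD.
by rewrite scale_scalar_mx addrCA mulrDl [in RHS]raddfD.
Qed.

(** Write the word as m + q w e with m in [M 5]. Its trace has w-coefficient 3 q, while [S_tr6]
    gives half the chirality; independence of 1 and w over S forces 6 q = chirality. *)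
Lemma word6 s : size s = 6 ->
  exists2 m, M 5 m & evx s *~ 6 = m + (w *~ chirality s)%:M.
Proof.
move=> s6; have [m [q [Mm Sq es]]] := fspan6_split (fspan_word (eq_leq s6) isT).
have Htr : t s = \tr m + (q * w) *+ 3 by rewrite es mxtraceD mxtrace_scalar.
have := S_tr6 xyS (eq_leq s6); set p := _ - _ => Sp.
have q6 : q *~ 6 - 1 *~ chirality s = 0.
  apply: (@w_free (\tr m *~ 2 - p)).
  - by apply: (S_sub xyS) => //; apply/(S_mulz xyS)/S_tr_fspan5.
  - by apply: (S_sub xyS); apply: (S_mulz xyS).
  by rewrite mulrBl mulrzl /p Htr; ring.
exists (m *~ 6); first exact: fspanMz.
rewrite es mulrzDl; congr (_ + _); rewrite -raddfMz; congr (_%:M).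
by rewrite -mulrzAl; move/eqP: q6; rewrite subr_eq0 => /eqP ->; rewrite mulrzl.
Qed.

Lemma fspan5_letter m b : M 5 m -> M 6 (m * letter b).
Proof.
apply: (mspan_mulr SM) => a [[i [j [ij i5 ->]]]|[]//].
by apply: fspan_mono (fam_step b ij i5 isT (words_upto_fspan _)); rewrite ?ltnS.
Qed.

Lemma word7 s b : size s = 6 ->
  exists2 m, M 6 m & evx (rcons s b) *~ 6 = m + (w *~ chirality s) *: letter b.
Proof.
move=> /word6[m Mm e]; exists (m * letter b); first exact: fspan5_letter.
by rewrite ev_rcons -mulrzAl e mulrDl -scalemx1 -scalerAl mul1r.
Qed.

(** The term of [word7] outside [M 6] is a multiple of a letter, hence traceless. *)
Lemma SSw_tr7 s b : size s = 6 -> SSw (t (rcons s b)).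
Proof.
move=> /(word7 b)[m Mm e]; apply: (@SSw_divz _ 6) => //.
have -> : t (rcons s b) *~ 6 = \tr m.
  rewrite -(raddfMz (@mxtrace R 3)) e /= mxtraceD mxtraceZ.
  by have := tr_letter xyS b; rewrite ev_cons ev_nil mulr1 => ->; rewrite mulr0 addr0.
exact: SSw_tr_fspan6.
Qed.

(* In the polarized identity for the words b b b' b', b b' and b, the words on the
   left contribute 2/6 w * b modulo M 6, while tr(b b b' b' b b') * b on the right
   contributes 1/2 w * b. *)
Lemma fspan6_w_letter b : M 6 (w *: letter b).
Proof.
pose a1 := [:: b; b; ~~ b; ~~ b]; pose a2 := [:: b; ~~ b].
have St s : (size s <= 5)%N -> S (t s) by exact: (S_tr5 xyS).
have Mw s : (size s <= 6)%N -> M 6 (evx s) by move=> s6; apply: fspan_word.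
have chi0 s c : size s = 6 -> chirality s = 0 -> M 6 (evx (rcons s c) *~ 6).
  by move=> /(word7 c)[m Mm ->] ->; rewrite mulr0z scale0r addr0.
(* The traces of length 7 multiply e only and are in S + S w. The single trace of length 6, that of
   [a1 ++ a2], multiplies the letter b and is set aside. *)
have rhs : M 6 (\sum_(u <- perms3 a1 a2 [:: b]) evx ([::] ++ u ++ [::])
     - t (a1 ++ a2) *: letter b).
  rewrite ev_perms3 (tr_letter xyS) !(mulr0, mul0r, subr0, scale0r, addr0).
  have -> : evx ([::] ++ [:: b] ++ [::]) = letter b by rewrite ev_cons ev_nil mulr1.
  rewrite scalerBl (addrC (_ *: letter b)) addrA.
  rewrite !(addrAC _ (t (a1 ++ a2) *: letter b)) subrK.
  have t7 (s : seq bool) : size s = 6 -> M 6 (t (rcons s b) *: evx ([::] ++ [::])).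
    by move=> s6; rewrite ev_nil scalemx1; apply/fspan6_SSw/SSw_tr7.
  have t7' : M 6 (t (a1 ++ [:: b] ++ a2) *: evx ([::] ++ [::])).
    have -> : t (a1 ++ [:: b] ++ a2) = t (rcons [:: b; ~~ b; ~~ b; b; b; ~~ b] b).
      by rewrite -[RHS](tr_ev_rot x y 6).
    exact: t7.
  have Ml : M 6 (letter b) by rewrite -[letter b]mulr1 -(ev_nil x y) -ev_cons; apply: Mw.
  rewrite !scalerDl !scalerDr !scaleNr scale0r -!scalerA.
  repeat (first [apply: fspanD | apply: fspanN]); last (by exact: t7'); last (by apply: (t7 (a1 ++ a2)));
  by repeat (first [apply: fspan0 | apply: Ml | apply: Mw => // | apply: fspanZ; first by apply: St]).
have dbl : M 6 ((t (a1 ++ a2) *: letter b) *~ 2 - (w *~ chirality (a1 ++ a2)) *: letter b).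
  rewrite scalerMzl -scalerBl -[letter b]mulr1 -(ev_nil x y) -ev_cons; apply: fspanZ; last exact: Mw.
  by apply: (S_tr6 xyS).
pose e := chirality (a1 ++ a2).
(* Among the six orders, only [a1 ++ a2 ++ [:: b]] and [a2 ++ a1 ++ [:: b]] have an initial segment
   of length 6 with nonzero chirality. *)
have sum6 : M 6 ((\sum_(u <- perms3 a1 a2 [:: b]) evx ([::] ++ u ++ [::])) *~ 6
    - ((w *~ e) *: letter b) *~ 2).
  have [m Mm em] := @word7 (a1 ++ a2) b erefl.
  have [m' Mm' em'] := @word7 (a2 ++ a1) b erefl.
  have n1 : M 6 (evx (rcons [:: b; b; ~~ b; ~~ b; b; b] (~~ b)) *~ 6).
    by apply: chi0 => //; case: (b).
  have n2 : M 6 (evx (rcons [:: b; ~~ b; b; b; b; ~~ b] (~~ b)) *~ 6).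
    by apply: chi0 => //; case: (b).
  have n3 : M 6 (evx (rcons [:: b; b; b; ~~ b; ~~ b; b] (~~ b)) *~ 6).
    by apply: chi0 => //; case: (b).
  have n4 : M 6 (evx (rcons [:: b; b; ~~ b; b; b; ~~ b] (~~ b)) *~ 6).
    by apply: chi0 => //; case: (b).
  have ee : chirality (a2 ++ a1) = e by rewrite /e /a1 /a2; case: (b).
  rewrite ee in em'.
  move: em em' n1 n2 n3 n4; rewrite !big_cons big_nil addr0 /e /a1 /a2 /=.
  move: (_ *: letter b) => W; rewrite !mulrzDl => -> ->.
  move: (evx _ *~ _) (evx _ *~ _) (evx _ *~ _) (evx _ *~ _) => A B C D n1 n2 n3 n4.
  rewrite (addrAC m' W) (addrA D) addrACA mulrzDr mulr1z addrK.
  by apply/fspanD => //; apply/fspanD => //; apply/fspanD => //; apply/fspanD => //; apply/fspanD.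
(* With W = e w b, A = t(a1 a2) b and B the sum over the six orders, 3 (2A - W) + 6 (B - A) - (6B -
   2W) = -W. *)
have key : M 6 ((w *~ e) *: letter b).
  have := fspanB (fspanD (fspanMz 3 dbl) (fspanMz 6 rhs)) sum6; rewrite -/e.
  move: (w *~ e *: _) (t _ *: _) (\sum_(_ <- _) _) => W A B.
  rewrite !mulrzBl -mulrzA -[_ * _]/(6 : int) (addrC (_ - _)) addrA subrK opprB [X in M 6 X]addrC addrA subrK.
  by rewrite -mulrzBr => /fspanN; rewrite -mulrNz mulr1z.
have : e = 1 \/ e = -1 by rewrite /e /a1 /a2; case: (b); [right|left].
by case=> ee; move: key; rewrite ee ?mulr1z ?mulrN1z ?scaleNr // => /fspanN; rewrite opprK.
Qed.

Lemma fspan6_letter a b : M 6 a -> M 6 (a * letter b).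
Proof.
apply: (mspan_mulr SM) => {}a [[i [j [ij i5 ->]]]|[_ ->]].
  exact/fspan5_letter/fspan_fam/fam_deg5.
by rewrite -scalemx1 -scalerAl mul1r; apply: fspan6_w_letter.
Qed.

Lemma fspan6_mul_word a s : M 6 a -> M 6 (a * evx s).
Proof.
elim: s a => [|b s IH] a Ma; first by rewrite ev_nil mulr1.
by rewrite ev_cons mulrA; apply/IH/fspan6_letter.
Qed.

Lemma fspan6_mul a b : M 6 a -> M 6 b -> M 6 (a * b).
Proof.
move=> Ma; have Mfam i j : M 6 (a * fam_mx i j).
  rewrite /fam_mx /nc_sum mulr_sumr; elim/big_ind: _ => [|u v|e _].
  - exact: fspan0.
  - exact: fspanD.
  by rewrite mulrzAr; apply/fspanMz/fspan6_mul_word.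
apply: (mspan_mull SM) => {}b [[i [j [_ _ ->]]]|[_ ->]]; first exact: Mfam.
(* Right multiplication by w e is turned into multiplication by a word: w e is 6 times the word
   [chiral] minus an element of [M 5]. *)
have [m Mm e] := @word6 chiral erefl.
have -> : w%:M = evx chiral *~ 6 - m by rewrite e (_ : chirality chiral = 1) // mulr1z [RHS]addrC addKr.
rewrite mulrBr mulrzAr; apply: fspanB; first exact/fspanMz/fspan6_mul_word.
by apply: (mspan_mull SM _ Mm) => c [[i [j [_ _ ->]]]|[]//]; apply: Mfam.
Qed.

Definition fam_sum (p : nat -> nat -> R) (q : R) : 'M[R]_3 :=
  \sum_(i < 9) \sum_(j < (sym_rank i).+1) p i j *: fam_mx i j + q *: w%:M.

Lemma fspan6_fam_sum a : M 6 a -> exists p q,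
  [/\ forall i j, S (p i j), S q & a = fam_sum p q].
Proof.
elim=> [|c a' b' Sc Va _ [p [q [Sp Sq ->]]]].
  exists (fun _ _ => 0), 0; split=> //; rewrite /fam_sum scale0r addr0 big1 // => i _.
  by rewrite big1 // => j _; rewrite scale0r.
case: Va => [[i [j [/andP[i9 jm] _ ->]]]|[_ ->]]; last first.
  by exists p, (c + q); split=> //; [exact: SD | rewrite /fam_sum scalerDl addrCA].
pose P i' j' := if (i' == i) && (j' == j) then c + p i' j' else p i' j'.
exists P, q; split=> //; first by move=> i' j'; rewrite /P; case: ifP => // _; apply: SD.
rewrite /fam_sum addrA; congr (_ + _).
rewrite (bigD1 (Ordinal i9)) //= [in RHS](bigD1 (Ordinal i9)) //= addrA; congr (_ + _); last first.
  apply: eq_bigr => i' ne; apply: eq_bigr => j' _; rewrite /P.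
  by case: eqP => // e; case/eqP: ne; apply: val_inj.
rewrite (bigD1 (@Ordinal (sym_rank i).+1 j jm)) //=.
rewrite [in RHS](bigD1 (@Ordinal (sym_rank i).+1 j jm)) //= addrA; congr (_ + _).
  by rewrite /P !eqxx scalerDl.
apply: eq_bigr => j' ne; rewrite /P eqxx /=.
by case: eqP => // e; case/eqP: ne; apply: val_inj.
Qed.

End Spanning.

(** * Linear independence over S *)

(* Pairs to a nonzero multiple of w with the (i, j)-th element, and to 0 with every
   other element of at most the same degree, under (a, b) |-> tr(ab) - tr(rev(ab)). *)
Definition fam_dual (i j : nat) : ncpoly :=
  match i, j with
  | 0, _ => [:: (1, chiral)]
  | 1, 0 => [:: (1, [:: X; Y; X; Y; Y])]
  | 1, _ => [:: (1, [:: X; X; Y; X; Y])]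
  | 2, 0 => [:: (1, [:: Y; Y; X; Y])]
  | 2, 1 => [:: (1, [:: X; X; Y; Y]); (-1, [:: Y; Y; X; X])]
  | 2, _ => [:: (1, [:: X; Y; X; X])]
  | 3, _ => [:: (1, [:: X; Y; Y; X])]
  | 4, 0 => [:: (2, [:: X; Y; Y]); (1, [:: Y; X; Y])]
  | 4, _ => [:: (1, [:: X; Y; X]); (2, [:: Y; X; X])]
  | 5, 0 => [:: (1, [:: Y; X; Y]); (-1, [:: X; Y; Y])]
  | 5, _ => [:: (1, [:: X; Y; X]); (-1, [:: Y; X; X])]
  | 6, 0 => [:: (1, [:: Y; Y])]
  | 6, 1 => [:: (1, [:: X; Y]); (1, [:: Y; X])]
  | 6, _ => [:: (1, [:: X; X])]
  | 7, _ => [:: (1, [:: X; Y]); (-1, [:: Y; X])]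
  | _, 0 => [:: (1, [:: Y])]
  | _, _ => [:: (1, [:: X])]
  end.

Definition nc_chirality (f : ncpoly) : int :=
  foldr (fun e c => e.1 * chirality e.2 + c) 0 f.

Definition fam_indices : seq (nat * nat) :=
  [seq (i, j) | i <- iota 0 9, j <- iota 0 (sym_rank i).+1].

Lemma mem_fam_indices i j : fam_index i j -> (i, j) \in fam_indices.
Proof. by case/andP=> i9 jm; apply/allpairsPdep; exists i, j; rewrite !mem_iota. Qed.

(** [fam_dual i0 j0] has degree 6 - [fam_deg i0], so its product with an element of smaller degree
    consists of words shorter than 6, whose chirality is 0. In equal degree the words were chosen
    dual to the family up to nonzero integers. *)
Lemma fam_dualP i j i0 j0 : fam_index i j -> fam_index i0 j0 ->
  (fam_deg i <= fam_deg i0)%N ->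
  all (fun e => (size e.2 <= 6)%N) (nc_mul (fam_nc i j) (fam_dual i0 j0)) /\
  (nc_chirality (nc_mul (fam_nc i j) (fam_dual i0 j0)) != 0) = ((i, j) == (i0, j0)).
Proof.
have ok : all (fun p0 => all (fun p => (fam_deg p.1 <= fam_deg p0.1)%N ==>
    (all (fun e => (size e.2 <= 6)%N) (nc_mul (fam_nc p.1 p.2) (fam_dual p0.1 p0.2)) &&
    ((nc_chirality (nc_mul (fam_nc p.1 p.2) (fam_dual p0.1 p0.2)) != 0) == (p == p0))))
    fam_indices) fam_indices by vm_compute.
move=> /mem_fam_indices ij /mem_fam_indices ij0 le_deg.
by have /andP[? /eqP ?] := implyP (allP (allP ok _ ij0) _ ij) le_deg.
Qed.

Lemma rev_necklace s : (size s <= 6)%N ->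
  [\/ chirality s = 0 /\ exists n, rot n (rev s) = s,
      chirality s = 1 /\ (exists n, rot n s = chiral) /\
        (exists n, rot n (rev s) = rev chiral)
    | chirality s = -1 /\ (exists n, rot n s = rev chiral) /\
        (exists n, rot n (rev s) = chiral)].
Proof.
have ok : all (fun k => all (fun s =>
    [|| (chirality s == 0) && has (fun n => rot n (rev s) == s) (iota 0 7),
        [&& chirality s == 1, has (fun n => rot n s == chiral) (iota 0 7)
          & has (fun n => rot n (rev s) == rev chiral) (iota 0 7)]
      | [&& chirality s == -1, has (fun n => rot n s == rev chiral) (iota 0 7)
          & has (fun n => rot n (rev s) == chiral) (iota 0 7)]])
    (all_words k)) (iota 0 7) by vm_compute.
move=> s6; have s7 : size s \in iota 0 7 by rewrite mem_iota.
have := allP (allP ok _ s7) _ (mem_all_words s).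
case/or3P=> [/andP[/eqP-> /hasP[n _ /eqP]]|/and3P[/eqP-> /hasP[n _ /eqP h1] /hasP[m _ /eqP h2]]
  |/and3P[/eqP-> /hasP[n _ /eqP h1] /hasP[m _ /eqP h2]]].
- by constructor 1; split=> //; exists n.
- by constructor 2; split=> //; split; [exists n | exists m].
by constructor 3; split=> //; split; [exists n | exists m].
Qed.

Section Independence.
Variables (R : idomainType) (x y : 'M[R]_3) (sigma : {rmorphism R -> R}).
Local Notation t s := (\tr (ev x y s)).
Local Notation w := (t chiral - t (rev chiral)).
Hypothesis sigma_tr : forall s, sigma (t s) = t (rev s).
Hypothesis int_neq0 : forall z : int, z != 0 -> z%:~R != 0 :> R.
Hypothesis w_neq0 : w != 0.

(** sigma fixes p and q and negates w; subtracting the image of the relation leaves 2 q w = 0. *)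
Lemma sigma_antifixed p q : sigma p = p -> sigma q = q -> p + q * w = 0 -> q = 0.
Proof.
move=> sp sq e; have := congr1 sigma e.
rewrite rmorph0 rmorphD rmorphM rmorphB /= !sigma_tr revK sp sq -opprB mulrN => e'.
have /eqP : q * w *~ 2 = 0 by rewrite -(subrr 0) -{1}e -e'; ring.
rewrite -mulrzr !mulf_eq0 (negPf w_neq0) orbF => /orP[/eqP //|].
by rewrite (negPf (@int_neq0 2 isT)).
Qed.

Let tau (a : 'M[R]_3) : R := \tr a - sigma (\tr a).

Lemma tau_sum I (r : seq I) (F : I -> 'M[R]_3) :
  tau (\sum_(i <- r) F i) = \sum_(i <- r) tau (F i).
Proof. by rewrite /tau raddf_sum rmorph_sum -sumrB. Qed.

Lemma tauZ p a : sigma p = p -> tau (p *: a) = p * tau a.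
Proof. by move=> sp; rewrite /tau mxtraceZ rmorphM /= sp mulrBr. Qed.

Lemma tau_word s : (size s <= 6)%N -> tau (ev x y s) = w *~ chirality s.
Proof.
rewrite /tau sigma_tr => /rev_necklace[[-> [n e]]|[-> [[n e] [m e']]]|[-> [[n e] [m e']]]].
- by rewrite -(tr_ev_rot x y n (rev s)) e subrr mulr0z.
- by rewrite -(tr_ev_rot x y m (rev s)) e' -(tr_ev_rot x y n s) e mulr1z.
by rewrite -(tr_ev_rot x y m (rev s)) e' -(tr_ev_rot x y n s) e mulrN1z opprB.
Qed.

Lemma tau_nc f : all (fun e => (size e.2 <= 6)%N) f ->
  tau (nc_sum (ev x y) f) = w *~ nc_chirality f.
Proof.
elim: f => [|e f IH] /=; first by rewrite /nc_sum big_nil /tau mxtrace0 rmorph0 subrr mulr0z.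
case/andP=> e6 /IH; rewrite /nc_sum !tau_sum big_cons => ->.
rewrite mulrzDr; congr (_ + _); rewrite -[RHS]mulrzA_C -(tau_word e6) /tau.
by rewrite (raddfMz (@mxtrace R 3)) /= rmorphMz mulrzBl.
Qed.

Lemma fam_free p q : (forall i j, sigma (p i j) = p i j) -> sigma q = q ->
  fam_sum x y p q = 0 -> q = 0 /\ forall i j, fam_index i j -> p i j = 0.
Proof.
move=> sp sq e0.
have tau0 : tau 0 = 0 by rewrite /tau mxtrace0 rmorph0 subrr.
(* tau kills the family, whose words are shorter than 6, while tau (w e) = 3 w - (- 3 w) = 6 w. *)
have q0 : q = 0.
  have tauD a b : tau (a + b) = tau a + tau b.
    by rewrite /tau mxtraceD rmorphD /= opprD addrACA.
  have := congr1 tau e0; rewrite tau0 /fam_sum tauD tauZ //.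
  rewrite tau_sum big1 ?add0r => [|i _]; last first.
    rewrite tau_sum big1 // => j _; rewrite tauZ // tau_nc.
      have ok : all (fun ij => nc_chirality (fam_nc ij.1 ij.2) == 0) fam_indices by vm_compute.
      have ij : fam_index i j by rewrite /fam_index ltn_ord -ltnS ltn_ord.
      by rewrite (eqP (allP ok _ (mem_fam_indices ij))) mulr0z mulr0.
    apply: sub_all (fam_homog (i := i) (j := j) _) => [e /eqP->|].
      exact: leq_trans (fam_deg5 _) _.
    by rewrite /fam_index ltn_ord -ltnS ltn_ord.
  rewrite /tau mxtrace_scalar rmorphMn rmorphB /= !sigma_tr revK -mulrnBl opprB => /eqP.
  rewrite mulf_eq0 => /orP[/eqP//|].
  rewrite (_ : _ *+ 3 = w * 6%:~R); last by ring.
  by rewrite mulf_eq0 (negPf w_neq0) (negPf (@int_neq0 6 isT)).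
split=> //; move: e0; rewrite /fam_sum q0 scale0r addr0 => e0.
suff H D i j : fam_index i j -> (D <= fam_deg i)%N -> p i j = 0.
  by move=> i j ij; apply: (H 0 i j ij).
(* Descending induction on degree: the terms of higher degree, on which the dual element is not
   controlled, have vanished already. *)
have [n nD] := ubnP (6 - D); elim: n D nD i j => // n IH D nD i0 j0 ij0 D_le.
have {}IH i j : fam_index i j -> (fam_deg i0 < fam_deg i)%N -> p i j = 0.
  by move=> ij ii0; apply: (IH D.+1 _ i j ij); have := fam_deg5 i; lia.
have := congr1 (fun a => tau (a * nc_sum (ev x y) (fam_dual i0 j0))) e0.
rewrite mul0r tau0 mulr_suml tau_sum.
have [i9 jm] := andP ij0.
have term i j : fam_index i j ->
    tau (p i j *: fam_mx x y i j * nc_sum (ev x y) (fam_dual i0 j0)) =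
    p i j * (w *~ (nc_chirality (nc_mul (fam_nc i j) (fam_dual i0 j0)) *+ ((i, j) == (i0, j0)))).
  move=> ij; rewrite -scalerAl tauZ //; case: (leqP (fam_deg i) (fam_deg i0)) => [le_deg|gt_deg].
    have [sz pair] := fam_dualP ij ij0 le_deg.
    (* By [pair] the multiplicity is the truth value of c != 0 for the chirality c, and c *+ (c !=
       0) = c. *)
    rewrite -nc_eval_mul tau_nc // -pair; case: eqP => [->|_] //.
  by rewrite IH // !mul0r.
rewrite (bigD1 (Ordinal i9)) //= mulr_suml tau_sum (bigD1 (@Ordinal (sym_rank i0).+1 j0 jm)) //=.
rewrite term // eqxx mulr1n big1 ?addr0 => [|j ne]; last first.
  rewrite term; last by rewrite /fam_index i9 -ltnS ltn_ord.
  by case: eqP => [[e]|_]; [case/eqP: ne; apply: val_inj | rewrite mulr0n mulr0z mulr0].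
rewrite big1 ?addr0 => [|i ne]; last first.
  rewrite mulr_suml tau_sum big1 // => j _.
  rewrite term; last by rewrite /fam_index ltn_ord -ltnS ltn_ord.
  by case: eqP => [[e _]|_]; [case/eqP: ne; apply: val_inj | rewrite mulr0n mulr0z mulr0].
have [_] := fam_dualP ij0 ij0 (leqnn _); rewrite eqxx => c0 /eqP.
by rewrite -mulrzr !mulf_eq0 (negPf w_neq0) (negPf (int_neq0 c0)) !orbF => /eqP.
Qed.

End Independence.

(** * The Jacobian criterion *)

Section Jacobian.
Variables (K : fieldType) (charK : [pchar K] =i pred0) (m n : nat).
Variable th : m.-tuple {mpoly K[n]}.

Lemma mderiv_comp_mpoly j (p : {mpoly K[m]}) :
  (p \mPo th)^`M(j) = \sum_(i < m) (p^`M(i) \mPo th) * (tnth th i)^`M(j).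
Proof.
pose Q (p : {mpoly K[m]}) :=
  (p \mPo th)^`M(j) = \sum_(i < m) (p^`M(i) \mPo th) * (tnth th i)^`M(j).
have QD p1 p2 : Q p1 -> Q p2 -> Q (p1 + p2).
  rewrite /Q comp_mpolyD mderivD => -> ->; rewrite -big_split; apply: eq_bigr => i _.
  by rewrite mderivD comp_mpolyD mulrDl.
have QM p1 p2 : Q p1 -> Q p2 -> Q (p1 * p2).
  rewrite /Q rmorphM mderivM /= => -> ->; rewrite mulr_suml mulr_sumr -big_split.
  apply: eq_bigr => i _; rewrite mderivM rmorphD !rmorphM /=; ring.
have QC c : Q c%:MP.
  rewrite /Q comp_mpolyC mderivC big1 // => i _.
  by rewrite mderivC comp_mpoly0 mul0r.
have QX i : Q 'X_i.
  rewrite /Q comp_mpolyXU -tnth_nth (bigD1 i) //= mderivX mnm1E eqxx -{1}(add0m U_(i)%MM) addmK scale1r mpolyX0.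
  rewrite comp_mpoly1 mul1r big1 ?addr0 // => i' ne.
  by rewrite mderivX mnm1E eq_sym (negPf ne) scale0r comp_mpoly0 mul0r.
change (Q p); elim/mpolyind: p => [|c mm p _ _ Qp]; first by rewrite -mpolyC0; exact: QC.
apply: QD => //; rewrite -mul_mpolyC; apply: (QM) => //.
rewrite mpolyXE_id; elim/big_ind: _ => [|? ?|i _]; [by rewrite -mpolyC1; exact: QC | exact: QM |].
elim: (mm i) => [|k IH]; first by rewrite expr0 -mpolyC1; exact: QC.
by rewrite exprS; apply: QM.
Qed.

Lemma mderiv_eq0_const (p : {mpoly K[m]}) :
  (forall i, p^`M(i) = 0) -> p = (p@_0%MM)%:MP.
Proof.
move=> dp; apply/mpolyP => u; rewrite mcoeffC.
case: (eqVneq u 0%MM) => [->|u0]; first by rewrite mulr1.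
rewrite mulr0.
have [i ui] : exists i, u i != 0.
  apply/existsP; apply: contraNT u0; rewrite negb_exists => /forallP u0.
  by apply/eqP/mnmP => i; rewrite mnm0E; apply/eqP; rewrite -[_ == _]negbK u0.
(* This coefficient of the derivative is [u i] times the coefficient of p at u, and [u i] is
   invertible in characteristic 0. *)
have := congr1 (mcoeff (u - U_(i))%MM) (dp i).
rewrite mcoeff0 mcoeff_mderiv submK; last by rewrite lep1mP.
by move/eqP; rewrite -mulr_natr mulf_eq0 ((pcharf0P K).1 charK) orbF => /eqP.
Qed.

Lemma msize_mderiv_lt i (p : {mpoly K[m]}) : p != 0 -> (msize p^`M(i) < msize p)%N.
Proof.
rewrite -msize_poly_eq0 -lt0n => p0; rewrite [X in (X < _)%N]msizeE big_seq.
rewrite (leq_ltn_trans (n := (msize p).-1)) ?prednK //; apply/bigmax_leqP_seq => u _ up.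
have : (u + U_(i))%MM \in msupp p.
  by move: up; rewrite !mcoeff_msupp mcoeff_mderiv; apply: contra => /eqP ->; rewrite mul0rn eqxx.
by move/msize_mdeg_lt; rewrite mdegD mdeg1 addn1; case: (msize p) p0.
Qed.

(** By the chain rule, differentiating a relation p gives a row killed by the Jacobian matrix J. The
    determinant of J N is nonzero because its value at [pt] is, so every partial derivative of p is
    again a relation, of smaller size. By induction all of them vanish, and p is constant. The
    columns of N select m tangent directions, which makes the matrix square. *)
Lemma jacobian_criterion (pt : 'I_n -> K) (N : 'M[K]_(n, m)) :
  (\matrix_(i < m, j < n) ((tnth th i)^`M(j)).@[pt]) *m N \in unitmx ->
  forall p, p \mPo th = 0 -> p = 0.
Proof.
set J0 := \matrix_(i, j) _ => J0N p.
have [k] := ubnP (msize p); elim: k p => // k IH p pk p0.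
pose J : 'M[{mpoly K[n]}]_(m, n) := \matrix_(i, j) (tnth th i)^`M(j).
pose JN := J *m map_mx (@mpolyC n K) N.
pose r : 'rV[{mpoly K[n]}]_m := \row_i (p^`M(i) \mPo th).
have rJ : r *m J = 0.
  apply/rowP => j; rewrite !mxE; under eq_bigr do rewrite !mxE.
  by rewrite -mderiv_comp_mpoly p0 mderiv0.
have detJN : \det JN != 0.
  apply: contraTneq J0N => d0; rewrite unitmxE unitfE negbK.
  rewrite (_ : J0 *m N = map_mx (meval pt) JN) ?det_map_mx ?d0 ?rmorph0 //.
  rewrite /JN map_mxM -map_mx_comp; congr (_ *m _); first by apply/matrixP => i j; rewrite !mxE.
  by apply/matrixP => i j; rewrite !mxE /= mevalC.
have r0 : r = 0.
  have : r *m JN *m \adj JN = 0 by rewrite /JN mulmxA rJ !mul0mx.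
  rewrite -mulmxA mul_mx_adj mul_mx_scalar => /rowP rj; apply/rowP => i.
  move: (rj i); rewrite [X in X = _ -> _]mxE [X in _ = X -> _]mxE => /eqP.
  by rewrite mulf_eq0 (negPf detJN) => /eqP ->; rewrite mxE.
have dp i : p^`M(i) = 0.
  have [->|pn0] := eqVneq p 0; first exact: mderiv0.
  apply: IH; first exact: leq_trans (msize_mderiv_lt i pn0) pk.
  by have /rowP/(_ i) := r0; rewrite !mxE.
have pC := mderiv_eq0_const dp; move: p0; rewrite pC comp_mpolyC => /eqP.
by rewrite mpolyC_eq0 => /eqP ->; rewrite mpolyC0.
Qed.

End Jacobian.

(** * The pure and mixed trace algebras *)

Section Subst.
Variable K : fieldType.
Implicit Types A B : M3 K.

Definition subst_tuple A B : nvar.-tuple {mpoly K[nvar]} :=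
  [tuple row_mx (mxvec A) (mxvec B) ord0 i | i < 3 * 3 + 3 * 3].

(** Bundled as a ring morphism; transposition of X and Y and the action of GL_2 are both
    instances. *)
Definition subst_morph A B : {rmorphism {mpoly K[nvar]} -> {mpoly K[nvar]}} :=
  @comp_mpoly nvar K nvar (subst_tuple A B).

Lemma subst_genX A B : map_mx (subst_morph A B) (genX K) = A.
Proof.
apply/matrixP => i j; rewrite !mxE /= comp_mpolyXU -tnth_nth tnth_mktuple.
by rewrite row_mxEl mxvecE.
Qed.

Lemma subst_genY A B : map_mx (subst_morph A B) (genY K) = B.
Proof.
apply/matrixP => i j; rewrite !mxE /= comp_mpolyXU -tnth_nth tnth_mktuple.
by rewrite row_mxEr mxvecE.
Qed.

Lemma substC A B c : subst_morph A B c%:MP = c%:MP.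
Proof. exact: comp_mpolyC. Qed.

Lemma map_mx_ev (R1 R2 : nzRingType) (f : {rmorphism R1 -> R2}) n (a b : 'M[R1]_n.+1) s :
  map_mx f (ev a b s) = ev (map_mx f a) (map_mx f b) s.
Proof.
elim: s => [|c s IH]; first by rewrite !ev_nil rmorph1.
by rewrite !ev_cons rmorphM /= IH; case: c.
Qed.

Lemma trmx_ev (R : comNzRingType) n (a b : 'M[R]_n.+1) s :
  (ev a b s)^T = ev a^T b^T (rev s).
Proof.
elim: s => [|c s IH]; first by rewrite !ev_nil trmx1.
by rewrite ev_cons rev_cons ev_rcons -IH trmx_mul; case: c.
Qed.

Lemma rmorph_tr_ev (R : comNzRingType) (f : {rmorphism R -> R}) n (a b : 'M[R]_n.+1) s :
  map_mx f a = a^T -> map_mx f b = b^T -> f (\tr (ev a b s)) = \tr (ev a b (rev s)).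
Proof.
move=> fa fb; rewrite -trace_map_mx map_mx_ev fa fb.
by rewrite -{1}(revK s) -trmx_ev mxtrace_tr.
Qed.

Lemma ev_chiral (A : nzRingType) (a b : A) : ev a b chiral = a ^+ 2 * b ^+ 2 * a * b.
Proof. by rewrite !ev_cons ev_nil mulr1 !expr2 !mulrA. Qed.

Lemma ev_rev_chiral (A : nzRingType) (a b : A) :
  ev a b [:: true; true; false; false; true; false] = b ^+ 2 * a ^+ 2 * b * a.
Proof. by rewrite !ev_cons ev_nil mulr1 !expr2 !mulrA. Qed.

Lemma map_tl (f : {rmorphism {mpoly K[nvar]} -> {mpoly K[nvar]}}) (a : M3 K) :
  (forall c, f c%:MP = c%:MP) ->
  map_mx f (a - Kscale 3%:R^-1 (\tr a)%:M) =
  map_mx f a - Kscale 3%:R^-1 (\tr (map_mx f a))%:M.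
Proof.
move=> fC; rewrite raddfB /= /Kscale map_mxZ fC map_scalar_mx.
by rewrite trace_map_mx.
Qed.

End Subst.

Section Instance.
Variables (K : fieldType) (charK : [pchar K] =i pred0).
Local Notation Om := {mpoly K[nvar]}.
Local Notation S := (@Salg K).
Local Notation x := (tlX K).
Local Notation y := (tlY K).
Local Notation w := (wtr K).
Local Notation v := (vtr K).
Local Notation t s := (\tr (ev x y s)).

Lemma natK_neq0 n : n.+1%:R != 0 :> K.
Proof. by rewrite ((pcharf0P K).1 charK). Qed.

Lemma intK_neq0 (z : int) : z != 0 -> z%:~R != 0 :> K.
Proof.
case: z => [[|n]|n] //= _; rewrite ?pmulrn ?NegzE ?mulrNz ?oppr_eq0; exact: natK_neq0.
Qed.

Lemma intOm_neq0 (z : int) : z != 0 -> z%:~R != 0 :> Om.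
Proof.
by move=> z0; rewrite -(rmorph_int (@mpolyC nvar K)) mpolyC_eq0 intK_neq0.
Qed.

Lemma tr_traceless (a : M3 K) : \tr (a - Kscale 3%:R^-1 (\tr a)%:M) = 0.
Proof.
rewrite /Kscale raddfB /= mxtraceZ mxtrace_scalar -(mulr_natl (\tr a) 3) mulrA.
rewrite -(rmorph_nat (@mpolyC nvar K)) -mpolyCM.
by rewrite mulVf ?natK_neq0 // mpolyC1 mul1r subrr.
Qed.

Lemma tr_tlX : \tr x = 0. Proof. exact: tr_traceless. Qed.
Lemma tr_tlY : \tr y = 0. Proof. exact: tr_traceless. Qed.

Lemma map_tlX (f : {rmorphism Om -> Om}) : (forall c, f c%:MP = c%:MP) ->
  map_mx f x = map_mx f (genX K) - Kscale 3%:R^-1 (\tr (map_mx f (genX K)))%:M.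
Proof. exact: map_tl. Qed.
Lemma map_tlY (f : {rmorphism Om -> Om}) : (forall c, f c%:MP = c%:MP) ->
  map_mx f y = map_mx f (genY K) - Kscale 3%:R^-1 (\tr (map_mx f (genY K)))%:M.
Proof. exact: map_tl. Qed.

Definition Salg_gens : seq Om := [:: \tr (genX K); \tr (genY K);
        \tr (x ^+ 2); \tr (x * y); \tr (y ^+ 2);
        \tr (x ^+ 3); \tr (x ^+ 2 * y); \tr (x * y ^+ 2); \tr (y ^+ 3); v].

Lemma Salg_gen i : (i < 10)%N -> S (nth 0 Salg_gens i).
Proof. by move=> i10; apply: subalg_gen; rewrite -/Salg_gens mem_nth. Qed.

Lemma SalgC c : S c%:MP. Proof. exact: subalg_cst. Qed.

Definition transp : {rmorphism Om -> Om} := subst_morph (genX K)^T (genY K)^T.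

Lemma transp_x : map_mx transp x = x^T.
Proof.
rewrite (map_tlX (f := transp)); last exact: substC.
by rewrite subst_genX mxtrace_tr /tlX /Kscale [in RHS]linearB [in RHS]linearZ /= tr_scalar_mx.
Qed.

Lemma transp_y : map_mx transp y = y^T.
Proof.
rewrite (map_tlY (f := transp)); last exact: substC.
by rewrite subst_genY mxtrace_tr /tlY /Kscale [in RHS]linearB [in RHS]linearZ /= tr_scalar_mx.
Qed.

(* Unification must not try to identify x with y by unfolding both. *)
Opaque tlX tlY.

Lemma vtr_factors : v = \tr (x * x * y * y) - \tr (x * y * x * y).
Proof. by rewrite /vtr /=; move: (x) (y) => a b; rewrite !expr2 !mulrA. Qed.

Lemma Salg_reduced : reduced_pair S x y.
Proof.
have e1 (A : nzRingType) (a b : A) : a * b * b = a * b ^+ 2 by rewrite expr2 mulrA.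
split.
- by rewrite -mpolyC0; apply: SalgC.
- by rewrite -mpolyC1; apply: SalgC.
- exact: subalg_add.
- by move=> p Sp; rewrite -mulN1r -mpolyC1 -mpolyCN; apply: subalg_mul => //; apply: SalgC.
- exact: subalg_mul.
- move=> z z0; exists (z%:~R^-1)%:MP; first exact: SalgC.
  rewrite -(mulrzr _ z) -(rmorph_int (@mpolyC nvar K)) -mpolyCM mulVf ?intK_neq0 //.
- exact: tr_tlX.
- exact: tr_tlY.
- by rewrite -expr2; apply: (@Salg_gen 2).
- exact: (@Salg_gen 3).
- by rewrite -expr2; apply: (@Salg_gen 4).
- by rewrite -expr2 -exprSr; apply: (@Salg_gen 5).
- by rewrite -expr2; apply: (@Salg_gen 6).
- by rewrite (e1 _ x y); apply: (@Salg_gen 7).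
- by rewrite -expr2 -exprSr; apply: (@Salg_gen 8).
by rewrite -vtr_factors; apply: (@Salg_gen 9).
Qed.

Lemma wtrE : w = t chiral - t (rev chiral).
Proof.
(* The definition of w uses yyxxyx, a rotation of the reversed word yxyyxx. *)
have -> : t (rev chiral) = t [:: true; true; false; false; true; false].
  by rewrite -(tr_ev_rot x y 2 (rev chiral)).
by rewrite ev_chiral ev_rev_chiral.
Qed.

Lemma transp_tr s : transp (t s) = t (rev s).
Proof. exact: rmorph_tr_ev transp_x transp_y. Qed.

Lemma Salg_gensE : Salg_gens = [:: \tr (genX K); \tr (genY K)] ++
  [seq t s | s <- [:: [:: X; X]; [:: X; Y]; [:: Y; Y]; [:: X; X; X]; [:: X; X; Y];
                      [:: X; Y; Y]; [:: Y; Y; Y]]] ++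
  [:: t [:: X; X; Y; Y] - t [:: X; Y; X; Y]].
Proof.
rewrite /Salg_gens /vtr /=; move: (\tr (genX K)) (\tr (genY K)) (x) (y) => trX trY a b.
by rewrite !ev_cons ev_nil !exprS !expr0 !mulr1 !mulrA.
Qed.

(** Apart from tr X and tr Y, the generators of S are combinations of traces of words whose reversal
    is one of their rotations. *)
Lemma transp_S p : S p -> transp p = p.
Proof.
have rotP s n : rev s = rot n s -> transp (t s) = t s.
  by rewrite transp_tr => ->; rewrite tr_ev_rot.
elim=> [{}p|c|p1 p2 _ e1 _ e2|p1 p2 _ e1 _ e2]; last 2 first.
- by rewrite rmorphD /= e1 e2.
- by rewrite rmorphM /= e1 e2.
- rewrite -/Salg_gens Salg_gensE !mem_cat => /or3P[|/mapP[s]|].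
  + by rewrite !inE => /orP[]/eqP->; rewrite -trace_map_mx ?subst_genX ?subst_genY mxtrace_tr.
  + have ok : all (fun s => has (fun n => rev s == rot n s) (iota 0 4))
       [:: [:: X; X]; [:: X; Y]; [:: Y; Y]; [:: X; X; X]; [:: X; X; Y];
           [:: X; Y; Y]; [:: Y; Y; Y]] by [].
    by move=> /(allP ok)/hasP[n _ /eqP e] ->; apply: rotP e.
  by rewrite inE => /eqP->; rewrite rmorphB /= (rotP _ 2) // (rotP _ 1).
exact: substC.
Qed.

End Instance.

(* 3x3 integer matrices as row-major lists, so that vm_compute can evaluate them. *)
Section IntMatrix.

Definition int_mx3 (R : nzRingType) (s : seq int) : 'M[R]_3 :=
  \matrix_(i < 3, j < 3) (s`_(i * 3 + j))%:~R.
Definition imul (s u : seq int) : seq int :=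
  mkseq (fun k => s`_(k %/ 3 * 3) * u`_(k %% 3) + s`_(k %/ 3 * 3 + 1) * u`_(3 + k %% 3)
     + s`_(k %/ 3 * 3 + 2) * u`_(6 + k %% 3)) 9.
Definition iadd (s u : seq int) : seq int := mkseq (fun k => s`_k + u`_k) 9.
Definition iscale (c : int) (s : seq int) : seq int := mkseq (fun k => c * s`_k) 9.
Definition ione : seq int := [:: 1; 0; 0; 0; 1; 0; 0; 0; 1].
Definition itr (s : seq int) : int := s`_0 + s`_4 + s`_8.

Variable R : nzRingType.

Lemma int_mx3M s u : int_mx3 R (imul s u) = int_mx3 R s * int_mx3 R u.
Proof.
apply/matrixP => i j; rewrite mul3E !mxE nth_mkseq; last first.
  by case: i j => [[|[|[|i]]] hi] [[|[|[|j]]] hj].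
have -> : ((i * 3 + j) %/ 3 = i)%N by rewrite divnMDl // divn_small ?addn0.
have -> : ((i * 3 + j) %% 3 = j)%N by rewrite modnMDl modn_small.
by rewrite !rmorphD !rmorphM /= addn0.
Qed.

Lemma int_mx3D s u : int_mx3 R (iadd s u) = int_mx3 R s + int_mx3 R u.
Proof.
apply/matrixP => i j; rewrite !mxE nth_mkseq ?rmorphD //.
by case: i j => [[|[|[|i]]] hi] [[|[|[|j]]] hj].
Qed.

Lemma int_mx3Z c s : int_mx3 R (iscale c s) = c%:~R *: int_mx3 R s.
Proof.
apply/matrixP => i j; rewrite !mxE nth_mkseq ?rmorphM //.
by case: i j => [[|[|[|i]]] hi] [[|[|[|j]]] hj].
Qed.

Lemma int_mx3_1 : int_mx3 R ione = 1.
Proof.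
apply/matrixP => i j; rewrite !mxE.
by case: i j => [[|[|[|i]]] hi] [[|[|[|j]]] hj].
Qed.

Lemma int_mx3_0 : int_mx3 R [::] = 0.
Proof. by apply/matrixP => i j; rewrite !mxE nth_nil. Qed.

Lemma int_mx3_tr s : \tr (int_mx3 R s) = (itr s)%:~R.
Proof. by rewrite tr3E !mxE !rmorphD. Qed.

Variables p q u v : seq int.

Fixpoint iev (s : seq bool) : seq int :=
  if s is b :: s' then imul (if b then q else p) (iev s') else ione.

(** Leibniz rule for [iev] at (p, q) in the direction (u, v). The empty list stands for the zero
    matrix, by the default value of [nth]. *)
Fixpoint idev (s : seq bool) : seq int :=
  if s is b :: s' then
    iadd (imul (if b then v else u) (iev s')) (imul (if b then q else p) (idev s'))
  else [::].

Lemma int_mx3_ev s : int_mx3 R (iev s) = ev (int_mx3 R p) (int_mx3 R q) s.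
Proof.
elim: s => [|b s IH]; first by rewrite ev_nil int_mx3_1.
by rewrite ev_cons -IH /= int_mx3M; case: b.
Qed.

End IntMatrix.

(** * Derivations applied to traces of words *)

Section Derivation.
Variables (A B : nzRingType) (f : {rmorphism A -> B}) (d : A -> B).
Hypothesis dD : forall p q, d (p + q) = d p + d q.
Hypothesis dM : forall p q, d (p * q) = d p * f q + f p * d q.

Lemma der0 : d 0 = 0.
Proof. by apply: (addrI (d 0)); rewrite -dD !addr0. Qed.

Lemma derN p : d (- p) = - d p.
Proof. by apply: (addrI (d p)); rewrite -dD !subrr der0. Qed.

Lemma der_sum (I : Type) (r : seq I) (F : I -> A) : d (\sum_(i <- r) F i) = \sum_(i <- r) d (F i).
Proof. by apply: (big_morph d dD der0). Qed.

Lemma der_tr n (a : 'M[A]_n) : d (\tr a) = \tr (map_mx d a).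
Proof. by rewrite /mxtrace der_sum; apply: eq_bigr => i _; rewrite mxE. Qed.

Lemma der_mx n (a b : 'M[A]_n.+1) :
  map_mx d (a * b) = map_mx d a * map_mx f b + map_mx f a * map_mx d b.
Proof.
apply/matrixP => i j; rewrite !mxE der_sum -big_split; apply: eq_bigr => k _.
by rewrite !mxE dM.
Qed.

Lemma der1 n : map_mx d 1 = 0 :> 'M[B]_n.+1.
Proof.
have := der_mx (1 : 'M_n.+1) 1; rewrite mul1r rmorph1 mulr1 mul1r => /eqP.
by rewrite -subr_eq0 opprD addrA subrr sub0r oppr_eq0 => /eqP.
Qed.

Lemma der_ev (a b : 'M[A]_3) (p q u v : seq int) s :
  map_mx f a = int_mx3 B p -> map_mx f b = int_mx3 B q ->
  map_mx d a = int_mx3 B u -> map_mx d b = int_mx3 B v ->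
  map_mx d (ev a b s) = int_mx3 B (idev p q u v s).
Proof.
move=> fa fb da db; elim: s => [|c s IH]; first by rewrite ev_nil der1 int_mx3_0.
rewrite ev_cons der_mx IH map_mx_ev fa fb /= int_mx3D !int_mx3M int_mx3_ev.
by case: c; rewrite ?fa ?fb ?da ?db.
Qed.

Lemma der_tr_int (a b : 'M[A]_3) (p q u v : seq int) s :
  map_mx f a = int_mx3 B p -> map_mx f b = int_mx3 B q ->
  map_mx d a = int_mx3 B u -> map_mx d b = int_mx3 B v ->
  d (\tr (ev a b s)) = (itr (idev p q u v s))%:~R.
Proof. by move=> *; rewrite der_tr -int_mx3_tr (@der_ev a b p q u v). Qed.

Lemma rmorph_tr_int (a b : 'M[A]_3) (p q : seq int) s :
  map_mx f a = int_mx3 B p -> map_mx f b = int_mx3 B q ->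
  f (\tr (ev a b s)) = (itr (iev p q s))%:~R.
Proof. by move=> fa fb; rewrite -trace_map_mx map_mx_ev fa fb -int_mx3_ev int_mx3_tr. Qed.

End Derivation.

(** * An integer point and tangent directions at it *)

Section Point.
Variables (K : fieldType) (charK : [pchar K] =i pred0).
Local Notation Om := {mpoly K[nvar]}.
Local Notation x := (tlX K).
Local Notation y := (tlY K).
Local Notation t s := (\tr (ev x y s)).

(** The traceless point (E13 - E21, E32 - E13) serves twice: w takes the value 1 there, and the
    differentials of the ten generators are independent there. *)
Definition pt_x : seq int := [:: 0; 0; 1; -1; 0; 0; 0; 0; 0].
Definition pt_y : seq int := [:: 0; 0; -1; 0; 0; 0; 0; 1; 0].

Definition mx_point (a b : 'M[K]_3) (j : 'I_nvar) : K := row_mx (mxvec a) (mxvec b) 0 j.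

Definition pt : 'I_nvar -> K := mx_point (int_mx3 K pt_x) (int_mx3 K pt_y).

Lemma pt_genX : map_mx (meval pt) (genX K) = int_mx3 K pt_x.
Proof.
by apply/matrixP => i j; rewrite !mxE mevalXU /pt /mx_point row_mxEl mxvecE mxE.
Qed.

Lemma pt_genY : map_mx (meval pt) (genY K) = int_mx3 K pt_y.
Proof.
by apply/matrixP => i j; rewrite !mxE mevalXU /pt /mx_point row_mxEr mxvecE mxE.
Qed.

(* If X varies by dX, then x varies by dx; multiplied by 3 to stay in the integers. *)
Definition traceless_part (dX dx : seq int) : bool :=
  iadd (iscale 3 dX) (iscale (- itr dX) ione) == iscale 3 dx.

Lemma traceless_partP dX dx : traceless_part dX dx ->
  int_mx3 K dX - 3%:R^-1 *: (\tr (int_mx3 K dX))%:M = int_mx3 K dx.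
Proof.
move/eqP/(congr1 (int_mx3 K)); rewrite int_mx3D !int_mx3Z int_mx3_1 => e.
have n3 : 3%:R != 0 :> K by apply: natK_neq0.
apply: (scalerI n3); rewrite -[RHS]e scalerBr scalerA mulfV // scale1r int_mx3_tr.
by rewrite rmorphN scaleNr -[in LHS]scalemx1.
Qed.

(** Stated for maps that are merely K-linear, so as to cover both evaluation at [pt] and directional
    derivatives. *)
Lemma map_traceless (f : Om -> K) (a : M3 K) :
  (forall c p, f (c%:MP * p) = c * f p) -> (forall p q, f (p - q) = f p - f q) ->
  f (\tr a) = \tr (map_mx f a) ->
  map_mx f (a - Kscale 3%:R^-1 (\tr a)%:M) =
  map_mx f a - 3%:R^-1 *: (\tr (map_mx f a))%:M.
Proof.
move=> fC fB ftr; have f0 : f 0 = 0 by rewrite -[0]subr0 fB subrr.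
apply/matrixP => i j; rewrite /Kscale !mxE fB fC; congr (_ - _ * _).
by case: eqP => _; rewrite ?mulr1n ?mulr0n ?ftr.
Qed.

Lemma pt_tlX : map_mx (meval pt) x = int_mx3 K pt_x.
Proof.
rewrite /tlX map_traceless ?pt_genX; first exact: traceless_partP.
- by move=> c p; rewrite mevalM mevalC.
- exact: mevalB.
by rewrite -pt_genX trace_map_mx.
Qed.

Lemma pt_tlY : map_mx (meval pt) y = int_mx3 K pt_y.
Proof.
rewrite /tlY map_traceless ?pt_genY; first exact: traceless_partP.
- by move=> c p; rewrite mevalM mevalC.
- exact: mevalB.
by rewrite -pt_genY trace_map_mx.
Qed.

Lemma pt_tr s : meval pt (t s) = (itr (iev pt_x pt_y s))%:~R.
Proof. exact: (rmorph_tr_int s pt_tlX pt_tlY). Qed.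

Lemma w_neq0 : t chiral - t (rev chiral) != 0.
Proof.
apply: contraTneq isT => w0; have := congr1 (meval pt) w0.
rewrite mevalB !pt_tr meval0 -rmorphB.
rewrite (_ : itr _ - itr _ = 1); last by vm_compute.
by move/eqP; rewrite oner_eq0.
Qed.

Section Direction.
Variables dX dY : seq int.
Let N := mx_point (int_mx3 K dX) (int_mx3 K dY).

(** Derivative at [pt] in the direction (dX, dY), a derivation along evaluation at [pt]. *)
Definition dpt (p : Om) : K := \sum_j (p^`M(j)).@[pt] * N j.

Lemma dptD p q : dpt (p + q) = dpt p + dpt q.
Proof.
by rewrite -big_split; apply: eq_bigr => j _; rewrite mderivD mevalD mulrDl.
Qed.

Lemma dptM p q : dpt (p * q) = dpt p * meval pt q + meval pt p * dpt q.
Proof.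
rewrite /dpt mulr_suml mulr_sumr -big_split; apply: eq_bigr => j _.
by rewrite mderivM mevalD !mevalM mulrDl mulrAC mulrA.
Qed.

Lemma dptX j : dpt 'X_j = N j.
Proof.
rewrite /dpt (bigD1 j) //= mderivX mnm1E eqxx -{1}(add0m U_(j)%MM) addmK scale1r mpolyX0.
rewrite meval1 mul1r big1 ?addr0 // => i ne.
by rewrite mderivX mnm1E eq_sym (negPf ne) scale0r meval0 mul0r.
Qed.

Lemma dptC c p : dpt (c%:MP * p) = c * dpt p.
Proof.
rewrite mulr_sumr; apply: eq_bigr => j _.
by rewrite mderiv_mulC mevalM mevalC mulrA.
Qed.

Lemma dpt_genX : map_mx dpt (genX K) = int_mx3 K dX.
Proof.
by apply/matrixP => i j; rewrite !mxE dptX /N /mx_point row_mxEl mxvecE mxE.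
Qed.

Lemma dpt_genY : map_mx dpt (genY K) = int_mx3 K dY.
Proof.
by apply/matrixP => i j; rewrite !mxE dptX /N /mx_point row_mxEr mxvecE mxE.
Qed.

Variables dx dy : seq int.
Hypotheses (dxP : traceless_part dX dx) (dyP : traceless_part dY dy).

Lemma dpt_tlX : map_mx dpt x = int_mx3 K dx.
Proof.
rewrite /tlX map_traceless ?dpt_genX; first exact: traceless_partP.
- exact: dptC.
- by move=> p q; rewrite dptD (derN dptD).
by rewrite -dpt_genX; apply: der_tr dptD _ _.
Qed.

Lemma dpt_tlY : map_mx dpt y = int_mx3 K dy.
Proof.
rewrite /tlY map_traceless ?dpt_genY; first exact: traceless_partP.
- exact: dptC.
- by move=> p q; rewrite dptD (derN dptD).
by rewrite -dpt_genY; apply: der_tr dptD _ _.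
Qed.

Lemma dpt_tr s : dpt (t s) = (itr (idev pt_x pt_y dx dy s))%:~R.
Proof. exact: (der_tr_int dptD dptM s pt_tlX pt_tlY dpt_tlX dpt_tlY). Qed.

End Direction.

End Point.

(** The out-of-range index k = 9 gives the zero matrix, which [tangents] exploits. *)
Definition unit_mx3 (k : nat) : seq int := mkseq (fun l => (l == k)%:Z) 9.

(* Chosen so that the differentials of the ten generators at the point have a
   diagonal matrix on them; each entry is ((dX, dY), (dx, dy)). *)
Definition tangents : seq (seq int * seq int * (seq int * seq int)) :=
  let d0 := unit_mx3 9 in
  let tl dX dY := ((dX, dY), (dX, dY)) in
  [:: ((ione, d0), (d0, d0)); ((d0, ione), (d0, d0));
      tl (unit_mx3 1) d0; tl d0 (unit_mx3 1); tl d0 (unit_mx3 5);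
      tl (iadd (unit_mx3 7) (unit_mx3 2)) d0; tl (unit_mx3 2) d0; tl d0 (unit_mx3 2);
      tl d0 (iadd (unit_mx3 3) (unit_mx3 2));
      tl (iadd (unit_mx3 0) (iscale (-1) (unit_mx3 8))) d0].

Definition dgens (T : seq int * seq int * (seq int * seq int)) : seq int :=
  let: ((dX, dY), (dx, dy)) := T in
  let D s := itr (idev pt_x pt_y dx dy s) in
  [:: itr dX; itr dY; D [:: X; X]; D [:: X; Y]; D [:: Y; Y]; D [:: X; X; X]; D [:: X; X; Y];
      D [:: X; Y; Y]; D [:: Y; Y; Y]; D [:: X; X; Y; Y] - D [:: X; Y; X; Y]].

Section Instance.
Variables (K : fieldType) (charK : [pchar K] =i pred0).
Local Notation Om := {mpoly K[nvar]}.
Local Notation S := (@Salg K).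
Local Notation x := (tlX K).
Local Notation y := (tlY K).
Local Notation t s := (\tr (ev x y s)).
Local Notation gens := (Salg_gens K).

Lemma dpt_gens dX dY dx dy i :
  traceless_part dX dx -> traceless_part dY dy -> (i < 10)%N ->
  @dpt K dX dY (nth 0 gens i) = ((dgens ((dX, dY), (dx, dy)))`_i)%:~R.
Proof.
move=> hx hy i10; have D := dpt_tr charK hx hy.
have tr_ := der_tr (dptD dX dY); rewrite Salg_gensE.
case: i i10 => [|[|[|[|[|[|[|[|[|[|//]]]]]]]]]] _; rewrite [nth _ _ _]/= [X in X%:~R]/=.
- by rewrite tr_ dpt_genX int_mx3_tr.
- by rewrite tr_ dpt_genY int_mx3_tr.
1-7: exact: D.
by rewrite dptD (derN (dptD _ _)) !D rmorphB.
Qed.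

Definition Salg_tuple : 10.-tuple Om := @Tuple 10 Om gens isT.

Lemma Salg_gens_free p : p \mPo Salg_tuple = 0 -> p = 0.
Proof.
pose T k := nth (nth (([::], [::]), ([::], [::])) tangents 0) tangents k.
pose N : 'M[K]_(nvar, 10) := \matrix_(j, k)
  mx_point (int_mx3 K (T k).1.1) (int_mx3 K (T k).1.2) j.
apply: (@jacobian_criterion _ charK _ _ _ (pt K) N).
(* The derivatives of the i-th generator along the i-th tangent direction; nonzero integers stay
   nonzero in characteristic 0. *)
pose d : 'rV[K]_10 := \row_(k < 10) (nth 0 [:: 3; 3; -2; -1; 2; -3; -1; -1; -3; 3] k : int)%:~R.
have -> : (\matrix_(i < 10, j < nvar) ((tnth Salg_tuple i)^`M(j)).@[pt K]) *m N = diag_mx d.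
  apply/matrixP => i k; rewrite !mxE.
  transitivity (@dpt K (T k).1.1 (T k).1.2 (nth 0 gens i)).
    by apply: eq_bigr => j _; rewrite !mxE (tnth_nth 0).
  have ok : all (fun k => let: ((dX, dY), (dx, dy)) := T k in
     [&& traceless_part dX dx, traceless_part dY dy &
      all (fun i => (dgens (T k))`_i ==
         (nth 0 [:: 3; 3; -2; -1; 2; -3; -1; -1; -3; 3] k) *+ (i == k)) (iota 0 10)]) (iota 0 10).
    by vm_compute.
  have k10 : val k \in iota 0 10 by rewrite mem_iota ltn_ord.
  have i10 : val i \in iota 0 10 by rewrite mem_iota ltn_ord.
  have := allP ok _ k10; case: (T k) => [[dX dY] [dx dy]] /and3P[hx hy /allP/(_ _ i10)/eqP e].
  rewrite (dpt_gens hx hy (ltn_ord i)) e; clear.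
  by rewrite (val_eqE i k); case: eqVneq => [->|_]; rewrite ?mulr0n ?mulr1n.
rewrite unitmxE det_diag unitfE; apply/prodf_neq0 => k _; rewrite mxE; apply: intK_neq0 => //.
have ok : all (fun k => nth 0 [:: 3; 3; -2; -1; 2; -3; -1; -1; -3; 3] k != 0 :> int) (iota 0 10).
  by vm_compute.
by apply: (allP ok); rewrite mem_iota ltn_ord.
Qed.

Lemma Salg_polynomial : exists f : {lrmorphism {mpoly K[10]} -> {mpoly K[nvar]}},
  injective f /\ forall p, Salg p <-> exists q, p = f q.
Proof.
pose f : {lrmorphism {mpoly K[10]} -> {mpoly K[nvar]}} := comp_mpoly Salg_tuple.
exists f; split.
  move=> p q; rewrite /f /= => e; apply/eqP; rewrite -subr_eq0; apply/eqP.
  by apply: Salg_gens_free; rewrite comp_mpolyB e subrr.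
move=> p; split=> [|[q ->]].
  elim=> [{}p|c|p1 p2 _ [q1 ->] _ [q2 ->]|p1 p2 _ [q1 ->] _ [q2 ->]].
  - rewrite -/(gens) => /(nthP 0)[i i10 <-]; exists 'X_(Ordinal i10).
    by rewrite /f /= comp_mpolyXU.
  - by exists c%:MP; rewrite /f /= comp_mpolyC.
  - by exists (q1 + q2); rewrite rmorphD.
  - by exists (q1 * q2); rewrite rmorphM.
have red := Salg_reduced charK.
rewrite /f /= comp_mpolyE; elim/big_ind: _ => [||u _].
- exact: redS0 red.
- exact: redSD red.
rewrite -mul_mpolyC; apply: (redSM red); first exact: SalgC.
elim/big_ind: _ => [||i _].
- exact: redS1 red.
- exact: redSM red.
have Si : S (tnth Salg_tuple i) by rewrite (tnth_nth 0); apply: (Salg_gen K (ltn_ord i)).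
elim: (u i) => [|k IH]; first by rewrite expr0; exact: redS1 red.
by rewrite exprS; exact: (redSM red Si IH).
Qed.

End Instance.

(** * The mixed trace algebra as a module over S *)

Section Instance.
Variables (K : fieldType) (charK : [pchar K] =i pred0).
Local Notation Om := {mpoly K[nvar]}.
Local Notation S := (@Salg K).
Local Notation x := (tlX K).
Local Notation y := (tlY K).
Local Notation t s := (\tr (ev x y s)).
Local Notation w := (t chiral - t (rev chiral)).
Let red := Salg_reduced charK.

Lemma w_free p q : S p -> S q -> p + q * w = 0 -> q = 0.
Proof.
move=> Sp Sq; apply: (sigma_antifixed (transp_tr K) (intOm_neq0 charK) (w_neq0 charK));
by apply: transp_S.
Qed.

Local Notation M := (mspan S (fam_upto x y 6)).

Lemma genX_tlX : genX K = x + (3%:R^-1%:MP * \tr (genX K))%:M.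
Proof. by rewrite /tlX /Kscale scale_scalar_mx subrK. Qed.
Lemma genY_tlY : genY K = y + (3%:R^-1%:MP * \tr (genY K))%:M.
Proof. by rewrite /tlY /Kscale scale_scalar_mx subrK. Qed.

Lemma M_gen b : M (if b then genY K else genX K).
Proof.
have Mxy c : M (if c then y else x).
  by have := fspan_word red (s := [:: c]) (k := 6) isT isT; rewrite ev_cons ev_nil mulr1.
have Mtr i : (i < 10)%N -> M (3%:R^-1%:MP * nth 0 (Salg_gens K) i)%:M.
  by move=> i10; apply: (fspan6_S red); apply: (redSM red); [apply: SalgC | apply: Salg_gen].
case: b.
  by apply: (eq_ind_r M _ genY_tlY); apply: (fspanD (Mxy true)); apply: (Mtr 1).
by apply: (eq_ind_r M _ genX_tlX); apply: (fspanD (Mxy false)); apply: (Mtr 0).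
Qed.

Lemma M_mul a b : M a -> M b -> M (a * b).
Proof. exact: (fspan6_mul red w_free). Qed.

Lemma M_Kword s : M (word K s).
Proof.
elim: s => [|b s IH]; first by rewrite /word big_nil -[1]/(1%:M); apply: (fspan6_S red (redS1 red)).
by rewrite /word big_cons; apply: M_mul IH; apply: M_gen.
Qed.

(** Words of every length in X and Y lie in [M], which is closed under products, and traces of
    elements of [M] lie in S + S w. This disposes of traces of all lengths at once. *)
Lemma M_C32 p : C32 p -> M p%:M.
Proof.
elim=> [{}p [s ->]|c|p1 p2 _ M1 _ M2|p1 p2 _ M1 _ M2].
- exact: (fspan6_SSw red (SSw_tr_fspan6 red (M_Kword s))).
- exact: (fspan6_S red (SalgC c)).
- by rewrite raddfD; apply: fspanD M1 M2.
by rewrite scalar_mxM; apply: M_mul.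
Qed.

Lemma M_T32 a : T32 a -> M a.
Proof.
elim=> [{}a [->|->|[p Cp ->]]|c|a1 a2 _ M1 _ M2|a1 a2 _ M1 _ M2].
- exact: (M_gen false).
- exact: (M_gen true).
- exact: M_C32.
- exact: (fspan6_S red (SalgC c)).
- exact: fspanD M1 M2.
exact: M_mul.
Qed.

Local Notation C := (@C32 K).
Local Notation T := (@T32 K).

Lemma C32C c : C c%:MP. Proof. exact: subalg_cst. Qed.
Lemma C32D p q : C p -> C q -> C (p + q). Proof. exact: subalg_add. Qed.
Lemma C32M p q : C p -> C q -> C (p * q). Proof. exact: subalg_mul. Qed.
Lemma C32_word s : C (\tr (word K s)). Proof. by apply: subalg_gen; exists s. Qed.
Lemma T32D a b : T a -> T b -> T (a + b). Proof. exact: subalg_add. Qed.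
Lemma T32M a b : T a -> T b -> T (a * b). Proof. exact: subalg_mul. Qed.
Lemma T32_scalar p : C p -> T p%:M.
Proof. by move=> Cp; apply: subalg_gen; constructor 3; exists p. Qed.
Lemma T32Z p a : C p -> T a -> T (p *: a).
Proof. by move=> Cp Ta; rewrite -mul_scalar_mx; apply: T32M Ta; apply: T32_scalar. Qed.

Lemma T32_0 : T 0.
Proof. by rewrite -[0](raddf0 (@scalar_mx _ 3)) -mpolyC0; apply/T32_scalar/C32C. Qed.
Lemma T32_1 : T 1.
Proof. by rewrite -[1]/(1%:M) -mpolyC1; apply/T32_scalar/C32C. Qed.
Lemma T32_sum (I : Type) (r : seq I) (F : I -> M3 K) :
  (forall i, T (F i)) -> T (\sum_(i <- r) F i).
Proof. by move=> TF; elim/big_ind: _ => //; [exact: T32_0 | exact: T32D]. Qed.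

(** The C32-span of the words in X and Y is closed under products, hence contains [T32], and the
    trace is C32-linear. *)
Lemma C32_tr_T32 a : T a -> C (\tr a).
Proof.
pose V (a : M3 K) := exists s, a = word K s.
have V1 : V 1 by exists [::]; rewrite /word big_nil.
have C1 : C 1 by rewrite -mpolyC1; apply: C32C.
have mulV b c : mspan C V b -> mspan C V c -> mspan C V (b * c).
  move=> Vb; apply: (mspan_mull C32M) => _ [s ->].
  apply: (mspan_mulr C32M _ Vb) => _ [u ->]; apply: (mspan_gen C1).
  by exists (u ++ s); rewrite /word big_cat.
have TV b : T b -> mspan C V b.
  elim=> [{}b [->|->|[p Cp ->]]|c|b1 b2 _ V1' _ V2|b1 b2 _ V1' _ V2].
  - by apply: (mspan_gen C1); exists [:: false]; rewrite /word big_seq1.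
  - by apply: (mspan_gen C1); exists [:: true]; rewrite /word big_seq1.
  - by rewrite -scalemx1; apply: (mspanZ C32M Cp); apply: (mspan_gen C1).
  - by rewrite -scalemx1; apply: (mspanZ C32M (C32C c)); apply: (mspan_gen C1).
  - exact: mspanD.
  exact: mulV.
move/TV; apply: mspan_tr => [|||_ [s ->]].
- by rewrite -mpolyC0; apply: C32C.
- exact: C32D.
- exact: C32M.
exact: C32_word.
Qed.

Lemma T32_gen b : T (if b then genY K else genX K).
Proof. by apply: subalg_gen; case: b; [constructor 2 | constructor 1]. Qed.

Lemma T32_tl a : T a -> T (a - Kscale 3%:R^-1 (\tr a)%:M).
Proof.
move=> Ta; rewrite /Kscale -scaleNr -mpolyCN; apply: T32D (Ta) _; apply: T32Z (C32C _) _.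
exact/T32_scalar/C32_tr_T32.
Qed.

Lemma T32_ev s : T (ev x y s).
Proof.
have Txy c : T (if c then y else x).
  by case: c; apply: T32_tl; [apply: (T32_gen true) | apply: (T32_gen false)].
elim: s => [|c s IH]; first by rewrite ev_nil; apply: T32_1.
by rewrite ev_cons; apply: T32M.
Qed.

Lemma T32_fam i j : T (fam_mx x y i j).
Proof.
apply: T32_sum => e; rewrite -[ev _ _ _]scale1r scalerMzl -(rmorph_int (@mpolyC nvar K)).
by apply: T32Z; [apply: C32C | apply: T32_ev].
Qed.

Lemma C32_w : C w.
Proof.
by rewrite -mulN1r -mpolyC1 -mpolyCN; apply: C32D; [|apply: C32M (C32C _) _];
 apply: C32_tr_T32; apply: T32_ev.
Qed.

Lemma Salg_C32 p : S p -> C p.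
Proof.
elim=> [{}p|c|p1 p2 _ Cp _ Cq|p1 p2 _ Cp _ Cq]; last 2 first.
- exact: C32D.
- exact: C32M.
- rewrite -/(Salg_gens K) Salg_gensE !mem_cat => /or3P[|/mapP[s _ ->]|].
  + by rewrite !inE => /orP[]/eqP->; apply/C32_tr_T32; [apply: (T32_gen false)|apply: (T32_gen true)].
  + exact/C32_tr_T32/T32_ev.
  rewrite inE => /eqP->.
  rewrite -mulN1r -mpolyC1 -mpolyCN; apply: C32D; [|apply: C32M (C32C _) _];
  by apply: C32_tr_T32; apply: T32_ev.
exact: C32C.
Qed.

Lemma T32_fam_sum p q : (forall i j, C (p i j)) -> C q -> T (fam_sum x y p q).
Proof.
move=> Cp Cq; apply: T32D.
  by apply: T32_sum => i; apply: T32_sum => j; apply: T32Z; last exact: T32_fam.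
by apply: T32Z => //; apply/T32_scalar/C32_w.
Qed.

Lemma T32P a : T a <-> exists p q, [/\ forall i j, S (p i j), S q & a = fam_sum x y p q].
Proof.
split=> [/M_T32/(fspan6_fam_sum red)//|[p [q [Sp Sq ->]]]].
by apply: T32_fam_sum => *; apply: Salg_C32.
Qed.

Lemma fam_sum_free p q : (forall i j, S (p i j)) -> S q ->
  fam_sum x y p q = 0 -> q = 0 /\ forall i j, fam_index i j -> p i j = 0.
Proof.
move=> Sp Sq; apply: (fam_free (transp_tr K) (intOm_neq0 charK) (w_neq0 charK)).
  by move=> i j; apply: transp_S.
exact: transp_S.
Qed.

End Instance.

(** * The basis of 18 elements and extension of scalars *)

Section Bases.
Variables (K : fieldType).
Local Notation Om := {mpoly K[nvar]}.
Local Notation x := (tlX K).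
Local Notation y := (tlY K).
Local Notation t s := (\tr (ev x y s)).
Local Notation w := (t chiral - t (rev chiral)).

(** The list has 17 entries; the last vector, w e, is the default value of [nth]. *)
Definition fam_basis (k : 'I_18) : M3 K :=
  nth w%:M [seq fam_mx x y ij.1 ij.2 | ij <- fam_indices] k.

Definition fam_coef (p : nat -> nat -> Om) q (k : 'I_18) : Om :=
  if (k < 17)%N then p (nth (0, 0)%N fam_indices k).1 (nth (0, 0)%N fam_indices k).2
  else q.

Lemma fam_sumE (p : nat -> nat -> Om) q :
  fam_sum x y p q = \sum_k fam_coef p q k *: fam_basis k.
Proof.
rewrite /fam_coef big_ord_recr /= {2}/fam_basis nth_default //= /fam_sum; congr (_ + _).
transitivity (\sum_(ij <- fam_indices) p ij.1 ij.2 *: fam_mx x y ij.1 ij.2).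
  rewrite /fam_indices big_allpairs_dep -[iota 0 9]/(index_iota 0 9) big_mkord.
  apply: eq_bigr => i _.
  by rewrite -[iota 0 _]/(index_iota 0 (sym_rank i).+1) big_mkord.
rewrite (big_nth (0, 0)%N) big_mkord; apply: eq_bigr => k _.
by rewrite /= ltn_ord /fam_basis (nth_map (0, 0)%N) //= ltn_ord.
Qed.

Lemma fam_basis_sum (P : 'I_18 -> Om) : \sum_k P k *: fam_basis k =
  fam_sum x y (fun i j => P (inord (index (i, j) fam_indices))) (P ord_max).
Proof.
rewrite fam_sumE /fam_coef; apply: eq_bigr => k _; congr (_ *: _).
case: ifP => [k17|/negbT]; last first.
  by rewrite -leqNgt => k17; congr (P _); apply: val_inj; apply/eqP; rewrite eqn_leq k17 -ltnS ltn_ord.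
by rewrite -surjective_pairing index_uniq // inord_val.
Qed.

Lemma fam_is_basis (R : Om -> Prop) (V : M3 K -> Prop) :
  (forall a, V a <-> exists p q, [/\ forall i j, R (p i j), R q & a = fam_sum x y p q]) ->
  (forall p q, (forall i j, R (p i j)) -> R q -> fam_sum x y p q = 0 ->
     q = 0 /\ forall i j, fam_index i j -> p i j = 0) ->
  is_basis R V fam_basis.
Proof.
move=> VP free; split=> [a|P RP].
  rewrite VP; split=> [[p [q [Rp Rq ->]]]|[P RP ->]].
    by exists (fam_coef p q); [move=> k; rewrite /fam_coef; case: ifP | exact: fam_sumE].
  rewrite fam_basis_sum; exists (fun i j : nat => P (inord (index (i, j) fam_indices))), (P ord_max).
  by split.
rewrite fam_basis_sum => /free[] => [i j||q0 p0 k]; rewrite ?RP //.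
have [k17|k17] := ltnP k 17; last first.
  rewrite -q0; congr (P _); apply: val_inj; apply/eqP.
  by rewrite eqn_leq k17 -ltnS ltn_ord.
have ij : nth (0, 0)%N fam_indices k \in fam_indices by apply: mem_nth.
have ok : all (fun ij => fam_index ij.1 ij.2) fam_indices by [].
have := p0 _ _ (allP ok _ ij).
by rewrite -surjective_pairing index_uniq // inord_val.
Qed.

(** Two bases over R1 are linked by transition matrices P and Q with entries in R1. These entries
    remain valid coefficients over R2, so b inherits spanning and freeness from b0. Applied with R1
    the constants and R2 = S. *)
Lemma is_basis_transfer (R1 R2 : Om -> Prop) (V W : M3 K -> Prop) m n
    (b0 : 'I_m -> M3 K) (b : 'I_n -> M3 K) :
  R1 0 -> R1 1 -> (forall p q, R1 p -> R1 q -> R1 (p + q)) ->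
  (forall p q, R1 p -> R1 q -> R1 (p * q)) -> (forall p, R1 p -> R1 (- p)) ->
  R2 0 -> (forall p q, R2 p -> R2 q -> R2 (p + q)) ->
  (forall p q, R2 p -> R2 q -> R2 (p * q)) -> (forall p, R1 p -> R2 p) ->
  is_basis R1 V b0 -> is_basis R1 V b -> is_basis R2 W b0 -> is_basis R2 W b.
Proof.
move=> z1 o1 D1 M1 N1 z2 D2 M2 R12 [V0 free0] [Vb freeb] [W0 freeW].
have coord l l' (c : 'I_l -> M3 K) (c' : 'I_l' -> M3 K) :
    (forall a, V a <-> exists2 p, forall i, R1 (p i) & a = \sum_i p i *: c i) ->
    (forall a, V a <-> exists2 p, forall i, R1 (p i) & a = \sum_i p i *: c' i) ->
    exists P : 'I_l -> 'I_l' -> Om, forall i, (forall k, R1 (P i k)) /\ c i = \sum_k P i k *: c' k.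
  move=> Vc Vc'; apply: (@fin_all_exists _ (fun _ => 'I_l' -> Om)
    (fun i p => (forall k, R1 (p k)) /\ c i = \sum_k p k *: c' k)) => i.
  have /Vc'[p Rp e] : V (c i).
    apply/Vc; exists (fun k => (k == i)%:R); first by move=> k; case: (k == i).
    rewrite (bigD1 i) //= eqxx scale1r big1 ?addr0 // => k /negPf ->.
    by rewrite scale0r.
  by exists p; split.
have sum_coord l l' (p : 'I_l -> Om) (P : 'I_l -> 'I_l' -> Om) (c' : 'I_l' -> M3 K) :
  \sum_i p i *: (\sum_k P i k *: c' k) = \sum_k (\sum_i p i * P i k) *: c' k.
  under eq_bigr do rewrite scaler_sumr; rewrite exchange_big; apply: eq_bigr => k _.
  by rewrite scaler_suml; apply: eq_bigr => i _; rewrite scalerA.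
have R_sum (R' : Om -> Prop) l (F : 'I_l -> Om) : R' 0 ->
    (forall p q, R' p -> R' q -> R' (p + q)) -> (forall i, R' (F i)) -> R' (\sum_i F i).
  by move=> ? ? ?; elim/big_ind: _.
have [P RP] := coord _ _ _ _ Vb V0.
have [Q RQ] := coord _ _ _ _ V0 Vb.
have bE (p : 'I_n -> Om) : \sum_i p i *: b i = \sum_k (\sum_i p i * P i k) *: b0 k.
  by rewrite -sum_coord; apply: eq_bigr => i _; case: (RP i) => _ <-.
have b0E (p : 'I_m -> Om) : \sum_k p k *: b0 k = \sum_i (\sum_k p k * Q k i) *: b i.
  by rewrite -sum_coord; apply: eq_bigr => i _; case: (RQ i) => _ <-.
have PQ i l : \sum_k P i k * Q k l = (i == l)%:R.
  apply/eqP; rewrite -subr_eq0; apply/eqP.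
  apply: (freeb (fun l => \sum_k P i k * Q k l - (i == l)%:R)) => [l'|].
    apply: (D1); last by apply: (N1); case: (i == l').
    by apply: (R_sum _ _ _ z1 D1) => k; apply: (M1); [case: (RP i) | case: (RQ k)].
  under eq_bigr do rewrite scalerBl; rewrite sumrB -(b0E (P i)) -(RP i).2.
  rewrite (bigD1 i) //= eqxx scale1r big1 ?addr0 ?subrr // => k /negPf.
  by rewrite eq_sym => ->; rewrite scale0r.
split=> [a|p Rp].
  rewrite W0; split=> [[p Rp ->]|[p Rp ->]].
    rewrite b0E; eexists; last reflexivity.
    by move=> i; apply: (R_sum _ _ _ z2 D2) => k; apply: (M2) => //; apply: (R12); case: (RQ k).
  rewrite bE; eexists; last reflexivity.
  by move=> i; apply: (R_sum _ _ _ z2 D2) => k; apply: (M2) => //; apply: (R12); case: (RP k).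
rewrite bE => /freeW p0 i.
have {}p0 k : \sum_i p i * P i k = 0.
  by apply: p0 => k'; apply: (R_sum _ _ _ z2 D2) => i'; apply: (M2) => //; apply: (R12); case: (RP i').
(* p = p (P Q) = (p P) Q, and p P = 0 by freeness of b0 over R2. *)
transitivity (\sum_k (\sum_i p i * P i k) * Q k i); last first.
  by rewrite big1 // => k _; rewrite p0 mul0r.
under [RHS]eq_bigr do rewrite mulr_suml; rewrite exchange_big /=.
rewrite (bigD1 i) //= [X in _ + X]big1 => [|i' ne].
  under eq_bigr do rewrite -mulrA; rewrite -mulr_sumr PQ eqxx mulr1 addr0 //.
by under eq_bigr do rewrite -mulrA; rewrite -mulr_sumr PQ (negPf ne) mulr0.
Qed.

End Bases.

(** * The GL_2-module G *)

Section FamilyElements.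
Variables (A : nzRingType) (a b : A).

Definition sym_el (m j : nat) : A :=
  match m, j with
  | 0, _ => 1
  | 1, 0 => a
  | 1, _ => b
  | _, 0 => a * a
  | _, 1 => a * b + b * a
  | _, _ => b * b
  end.

Definition op_el (i : nat) (u : A) : A :=
  match i with
  | 0 | 1 | 2 => u
  | 3 | 4 | 6 => bracket a b * u
  | 5 => u * bracket a b + bracket a b * u
  | _ => bracket a b * bracket a b * u
  end.

Lemma nc_sum_sym m j : nc_sum (ev a b) (sym_nc m j) = sym_el m j.
Proof.
by case: m j => [|[|m]] [|[|j]]; rewrite /nc_sum !big_cons big_nil !(ev_cons, ev_nil)
   ?mulr1 ?mulr1z ?addr0.
Qed.

Lemma nc_sum_comm : nc_sum (ev a b) comm_nc = bracket a b.
Proof. by rewrite /nc_sum !big_cons big_nil !ev_cons !ev_nil !mulr1 mulrN1z mulr1z addr0. Qed.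

Lemma nc_sum_fam i j : nc_sum (ev a b) (fam_nc i j) = op_el i (sym_el (sym_rank i) j).
Proof.
rewrite /fam_nc; do 8? [case: i => [|i]]; move: (sym_rank _) => m; rewrite /op_nc /op_el;
by rewrite !(nc_sum_cat, nc_eval_mul, nc_sum_comm, nc_sum_sym).
Qed.

End FamilyElements.

(* The action of g on the basis of Sym^m, m <= 2, formed by the sym_el. *)
Definition sym_entry (R : comNzRingType) (m : nat) (g : 'M[R]_2) (l j : nat) : R :=
  match m with
  | 0 => 1
  | 1 => match l, j with
         | 0, 0 => g 0 0 | 0, _ => g 0 1 | _, 0 => g 1 0 | _, _ => g 1 1
         end
  | _ => match l, j with
         | 0, 0 => g 0 0 ^+ 2 | 0, 1 => g 0 0 * g 0 1 *+ 2 | 0, _ => g 0 1 ^+ 2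
         | 1, 0 => g 0 0 * g 1 0 | 1, 1 => g 0 0 * g 1 1 + g 1 0 * g 0 1
         | 1, _ => g 0 1 * g 1 1
         | _, 0 => g 1 0 ^+ 2 | _, 1 => g 1 0 * g 1 1 *+ 2 | _, _ => g 1 1 ^+ 2
         end
  end.

Definition det_rank (i : nat) : nat := nth 0 [:: 0; 0; 0; 1; 1; 1; 1; 2; 2] i.

Section Equivariance.
Variables (R : comNzRingType) (A : algType R) (a b : A) (f : {rmorphism A -> A}) (g : 'M[R]_2).
Hypothesis fa : f a = g 0 0 *: a + g 1 0 *: b.
Hypothesis fb : f b = g 0 1 *: a + g 1 1 *: b.

Lemma det2 (h : 'M[R]_2) : \det h = h 0 0 * h 1 1 - h 1 0 * h 0 1.
Proof.
rewrite (expand_det_row _ 0) !big_ord_recl big_ord0 /cofactor !det_mx11 !mxE /=.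
have -> : lift ord0 ord0 = 1 :> 'I_2 by apply: val_inj.
have -> : lift 1 0 = 0 :> 'I_2 by apply: val_inj.
by rewrite expr0 expr1; ring.
Qed.

(** Coordinates on the four noncommutative monomials of degree 2, so that identities in A become
    identities of scalars that [ring] decides. *)
Let comb (c1 c2 c3 c4 : R) : A :=
  c1 *: (a * a) + c2 *: (a * b) + c3 *: (b * a) + c4 *: (b * b).

Lemma comb_mul p q p' q' :
  (p *: a + q *: b) * (p' *: a + q' *: b) = comb (p * p') (p * q') (q * p') (q * q').
Proof. by rewrite !mulrDl !mulrDr -!scalerAl -!scalerAr !scalerA addrA. Qed.

Lemma combD c1 c2 c3 c4 d1 d2 d3 d4 : comb c1 c2 c3 c4 + comb d1 d2 d3 d4 =
  comb (c1 + d1) (c2 + d2) (c3 + d3) (c4 + d4).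
Proof. by rewrite /comb !scalerDl addrACA; congr (_ + _); rewrite addrACA; congr (_ + _); rewrite addrACA. Qed.

Lemma combZ c c1 c2 c3 c4 : c *: comb c1 c2 c3 c4 = comb (c * c1) (c * c2) (c * c3) (c * c4).
Proof. by rewrite /comb !scalerDr !scalerA. Qed.

Lemma combE : [/\ a * a = comb 1 0 0 0, a * b = comb 0 1 0 0, b * a = comb 0 0 1 0
  & b * b = comb 0 0 0 1].
Proof. by rewrite /comb !scale0r !scale1r !addr0 !add0r. Qed.

Lemma f_bracket : f (bracket a b) = \det g *: bracket a b.
Proof.
have [_ eab eba _] := combE.
rewrite /bracket rmorphB !rmorphM /= fa fb det2 !comb_mul eab eba -!scaleN1r.
by rewrite !combZ !combD combZ; congr comb; ring.
Qed.

Lemma f_sym m j : (m <= 2)%N -> (j <= m)%N ->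
  f (sym_el a b m j) = \sum_(l < m.+1) sym_entry m g l j *: sym_el a b m l.
Proof.
have [eaa eab eba ebb] := combE.
case: m j => [|[|[|//]]] [|[|[|//]]] // _ _; rewrite !big_ord_recl big_ord0 addr0 /=.
- by rewrite rmorph1 scale1r.
- exact: fa.
- exact: fb.
- by rewrite rmorphM /= fa comb_mul eaa eab eba ebb !combZ !combD ?combZ ?combD; congr comb; ring.
- by rewrite rmorphD !rmorphM /= fa fb !comb_mul eaa eab eba ebb !combZ !combD ?combZ ?combD; congr comb; ring.
by rewrite rmorphM /= fb comb_mul eaa eab eba ebb !combZ !combD ?combZ ?combD; congr comb; ring.
Qed.

Lemma f_op i u : (i < 9)%N -> f (op_el a b i u) = \det g ^+ det_rank i *: op_el a b i (f u).
Proof.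
have fbr := f_bracket; move=> i9.
do 7? [case: i i9 => [|i] i9]; rewrite /op_el ?rmorphD ?rmorphM ?rmorphM /= ?fbr ?expr0 ?scale1r ?expr1
  -?scalerAr -?scalerAl ?scalerA ?scalerDr //.
by rewrite -expr2; case: i i9 => [|[|//]].
Qed.

Lemma op_elZ i c u : op_el a b i (c *: u) = c *: op_el a b i u.
Proof.
by do 8? [case: i => [|i]]; rewrite /op_el -?scalerAr -?scalerAl // -scalerDr.
Qed.

Lemma op_el_sum i (I : Type) (r : seq I) (F : I -> A) :
  op_el a b i (\sum_(k <- r) F k) = \sum_(k <- r) op_el a b i (F k).
Proof.
by do 8? [case: i => [|i]]; rewrite /op_el ?mulr_sumr ?mulr_suml // -big_split.
Qed.

Lemma sym_rank2 i : (sym_rank i <= 2)%N.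
Proof. by rewrite /sym_rank; do 9? [case: i => [//|i]]; rewrite nth_default. Qed.

Lemma f_fam i j : (i < 9)%N -> (j <= sym_rank i)%N ->
  f (op_el a b i (sym_el a b (sym_rank i) j)) =
  \sum_(l < (sym_rank i).+1) (\det g ^+ det_rank i * sym_entry (sym_rank i) g l j)
     *: op_el a b i (sym_el a b (sym_rank i) l).
Proof.
move=> i9 ji; rewrite f_op // f_sym ?sym_rank2 // op_el_sum scaler_sumr; apply: eq_bigr => l _.
by rewrite op_elZ scalerA.
Qed.

End Equivariance.

(** * The representations det^k (x) Sym^m for m at most 2 *)

Section Representation.
Variable R : comNzRingType.
Implicit Types g h : 'M[R]_2.

(** Defined over any commutative ring: a matrix of variables yields the polynomial entries required
    by [gl_polynomial], and Omega the action on the family. *)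
Definition rhoW (m k : nat) g : 'M[R]_m.+1 :=
  \det g ^+ k *: \matrix_(l, j) sym_entry m g l j.

Lemma mul2E g h i j : (g *m h) i j = g i 0 * h 0 j + g i 1 * h 1 j.
Proof.
rewrite mxE !big_ord_recl big_ord0 addr0.
by have -> : lift ord0 ord0 = 1 :> 'I_2 by apply: val_inj.
Qed.

Lemma sym_entryM m g h l j : (m <= 2)%N -> (l <= m)%N -> (j <= m)%N ->
  sym_entry m (g *m h) l j = \sum_(i < m.+1) sym_entry m g l i * sym_entry m h i j.
Proof.
case: m l j => [|[|[|//]]] [|[|[|//]]] // [|[|[|//]]] // _ _ _;
by rewrite !big_ord_recl big_ord0 /= ?mul2E; ring.
Qed.

Lemma rhoWM m k g h : (m <= 2)%N -> rhoW m k (g *m h) = rhoW m k g *m rhoW m k h.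
Proof.
move=> m2; rewrite /rhoW det_mulmx exprMn -scalemxAl -scalemxAr scalerA; congr (_ *: _).
apply/matrixP => l j; rewrite !mxE (sym_entryM _ _ m2 (ltn_ord l) (ltn_ord j)).
by apply: eq_bigr => i _; rewrite !mxE.
Qed.

Lemma rhoW1 m k : (m <= 2)%N -> rhoW m k 1%:M = 1%:M.
Proof.
move=> m2; rewrite /rhoW det1 expr1n scale1r; apply/matrixP => l j; rewrite !mxE.
case: m m2 l j => [|[|[|//]]] _ [[|[|[|l]]] hl] [[|[|[|j]]] hj] //=;
by rewrite !mxE /= ?mulr1n ?mulr0n; ring.
Qed.

End Representation.

Lemma rhoW_map (R R' : comNzRingType) (f : {rmorphism R -> R'}) m k (g : 'M[R]_2) :
  map_mx f (rhoW m k g) = rhoW m k (map_mx f g).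
Proof.
rewrite /rhoW map_mxZ rmorphXn /= det_map_mx; congr (_ *: _).
apply/matrixP => l j; rewrite !mxE /sym_entry.
case: m l j => [|[|m]] [[|[|l]] hl] [[|[|j]] hj] //=;
by rewrite ?mxE ?rmorph1 ?rmorphXn ?rmorphMn ?rmorphD ?rmorphM //= ?mxE ?rmorphM.
Qed.

Section Irreducibility.
Variables (K : fieldType) (charK : [pchar K] =i pred0) (m k : nat) (m2 : (m <= 2)%N).
Local Notation rho := (@rhoW K m k).

Definition gl2 (a b c d : K) : 'M[K]_2 :=
  \matrix_(i, j) (if i == 0 then (if j == 0 then a else b) else (if j == 0 then c else d)).

Lemma gl2E a b c d : [/\ gl2 a b c d 0 0 = a, gl2 a b c d 0 1 = b,
  gl2 a b c d 1 0 = c & gl2 a b c d 1 1 = d].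
Proof. by split; rewrite mxE. Qed.

Lemma gl2_unit a b c d : a * d - c * b != 0 -> gl2 a b c d \in unitmx.
Proof. by rewrite unitmxE unitfE det2; have [-> -> -> ->] := gl2E a b c d. Qed.

Lemma rhoW_mulE g (v : 'cV[K]_m.+1) l :
  (rho g *m v) l 0 = \det g ^+ k * \sum_(j < m.+1) sym_entry m g l j * v j 0.
Proof.
by rewrite /rhoW -scalemxAl mxE; congr (_ * _); rewrite mxE; apply: eq_bigr => j _; rewrite mxE.
Qed.

Lemma sym_entry_swap i j : (i <= m)%N -> (j <= m)%N ->
  sym_entry m (gl2 0 1 1 0) i j = ((i + j)%N == m)%:R.
Proof.
have [g00 g01 g10 g11] := gl2E 0 1 1 0; rewrite /sym_entry ?g00 ?g01 ?g10 ?g11.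
case: m m2 i j => [|[|[|//]]] _ [|[|[|//]]] // [|[|[|//]]] // _ _;
by rewrite /= ?expr0n ?expr1n ?mul0r ?mulr0 ?mulr1 ?addr0 ?add0r ?mul0rn.
Qed.

Lemma sym_entry_shear i : (i <= m)%N -> sym_entry m (gl2 1 0 1 1) i 0%N = 1.
Proof.
have [g00 g01 g10 g11] := gl2E 1 0 1 1; rewrite /sym_entry ?g00 ?g01 ?g10 ?g11.
by case: m m2 i => [|[|[|//]]] _ [|[|[|//]]] // _; rewrite /= ?expr1n ?mulr1.
Qed.

Lemma sym_entry_upper j : (j <= m)%N -> sym_entry m (gl2 1 1 0 1) 0%N j = 'C(m, j)%:R.
Proof.
have [g00 g01 g10 g11] := gl2E 1 1 0 1; rewrite /sym_entry ?g00 ?g01 ?g10 ?g11.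
by case: m m2 j => [|[|[|//]]] _ [|[|[|//]]] // _; rewrite /= ?expr1n ?mulr1.
Qed.

Lemma sym_entry_diag c i j : (i <= m)%N -> (j <= m)%N ->
  sym_entry m (gl2 1 0 0 c) i j = c ^+ i *+ (i == j).
Proof.
have [g00 g01 g10 g11] := gl2E 1 0 0 c; rewrite /sym_entry ?g00 ?g01 ?g10 ?g11.
by case: m m2 i j => [|[|[|//]]] _ [|[|[|//]]] // [|[|[|//]]] // _ _;
rewrite /= ?expr0n ?expr1n ?mul0r ?mulr0 ?mulr1 ?mul1r ?addr0 ?add0r ?mul0rn.
Qed.

(** A predicate, so that it can be either an invariant subspace or the condition that the image of a
    vector lies in a submodule of [M3 K]. *)
Variable P : 'cV[K]_m.+1 -> Prop.
Hypotheses (P0 : P 0) (Plin : forall c u v, P u -> P v -> P (c *: u + v)).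
Hypothesis Prho : forall g v, g \in unitmx -> P v -> P (rho g *m v).

Let PZ c u : P u -> P (c *: u).
Proof. by move=> Pu; rewrite -[_ *: _]addr0; apply: Plin. Qed.
Let PD u v : P u -> P v -> P (u + v).
Proof. by move=> Pu Pv; rewrite -[u]scale1r; apply: Plin. Qed.
Let PZK c u : c != 0 -> P (c *: u) -> P u.
Proof. by move=> c0 Pcu; rewrite -[u]scale1r -(mulVf c0) -scalerA; apply: PZ. Qed.
Let PB u v : P u -> P v -> P (u - v).
Proof. by move=> Pu Pv; rewrite -scaleN1r addrC; apply: Plin. Qed.

Let le_m (i : 'I_m.+1) : (i <= m)%N. Proof. exact: (ltn_ord i). Qed.

(** Up to nonzero scalars, swapping x and y takes the first basis vector to the last, and the shear
    x -> x + y takes it to the sum of all. As m is at most 2, subtraction leaves the only possible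
    middle vector. *)
Lemma rhoW_generated : P (delta_mx 0 0) -> forall v, P v.
Proof.
move=> Pe0; suff Pe (l : 'I_m.+1) : P (delta_mx l 0).
  move=> v; rewrite [v]matrix_sum_delta; elim/big_ind: _ => // l _.
  by rewrite big_ord_recl big_ord0 addr0 (ord1 ord0); apply: PZ.
have col_e0 g : g \in unitmx -> P (\col_(i < m.+1) sym_entry m g i 0%N).
  move=> ug; apply: (@PZK (\det g ^+ k)); first by rewrite expf_neq0 // -unitfE -unitmxE.
  have := Prho ug Pe0; congr P; apply/matrixP => i j; rewrite (ord1 j) rhoW_mulE !mxE.
  congr (_ * _); rewrite (bigD1 ord0) //= mxE !eqxx mulr1 big1 ?addr0 // => i' ne.
  by rewrite mxE (negPf ne) mulr0.
have uswap : gl2 0 1 1 0 \in unitmx.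
  by apply: gl2_unit; rewrite mul0r mul1r sub0r oppr_eq0 oner_eq0.
have ushear : gl2 1 0 1 1 \in unitmx by apply: gl2_unit; rewrite mul1r mulr0 subr0 oner_eq0.
have Plast : P (delta_mx ord_max 0).
  have := col_e0 _ uswap; congr P; apply/matrixP => i j.
  by rewrite (ord1 j) !mxE (sym_entry_swap (le_m i) (leq0n m)) addn0 eqxx andbT.
have [l0|l0] := eqVneq l ord0; first by rewrite l0.
have [lm|lm] := eqVneq l ord_max; first by rewrite lm.
have := PB (PB (col_e0 _ ushear) Pe0) Plast; congr P; apply/matrixP => i j.
rewrite (ord1 j) !mxE (sym_entry_shear (le_m i)) eqxx !andbT.
have om : (ord0 : 'I_m.+1) != ord_max.
  apply: contraNneq l0 => /(congr1 val) /= m0; rewrite -val_eqE /= -leqn0 m0; exact: le_m.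
have [->|i0] := eqVneq i ord0.
  by rewrite (negPf om) [ord0 == l]eq_sym (negPf l0) subrr subr0.
have [->|im] := eqVneq i ord_max.
  by rewrite [ord_max == l]eq_sym (negPf lm) subr0 subrr.
rewrite !subr0 (_ : i == l) //; move: l0 lm i0 im (ltn_ord i) (ltn_ord l) m2.
by rewrite -!val_eqE /=; lia.
Qed.

(** diag(1, 2) multiplies the l-th basis vector by 2^(k + l), and these weights are distinct in
    characteristic 0. Subtracting the scalar 2^(k + l0) removes the coordinate l0; doing so for l0 =
    1, ..., m isolates the first coordinate if it is nonzero. *)
Lemma rhoW_highest v : v != 0 -> P v -> P (delta_mx 0 0).
Proof.
have n2 : 2%:R != 0 :> K by apply: natK_neq0.
have det_dg : \det (gl2 1 0 0 2%:R) = 2%:R.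
  by rewrite det2; have [-> -> -> ->] := gl2E 1 0 0 2%:R; rewrite mul1r mul0r subr0.
have ud : gl2 1 0 0 2%:R \in unitmx by rewrite unitmxE unitfE det_dg.
have kill l0 u : P u -> P (\col_(l < m.+1) ((2%:R ^+ l - 2%:R ^+ l0) * u l 0)).
  move=> Pu; apply: (@PZK (2%:R ^+ k)); first exact: expf_neq0.
  have := PB (Prho ud Pu) (PZ (2%:R ^+ k * 2%:R ^+ l0) Pu); congr P.
  apply/matrixP => l j; rewrite (ord1 j) mxE rhoW_mulE det_dg !mxE mulrBl mulrBr !mulrA.
  congr (_ - _); rewrite (bigD1 l) //= big1 => [|i ne].
    by rewrite (sym_entry_diag _ (le_m l) (le_m l)) eqxx mulr1n addr0 mulrA.
  by rewrite (sym_entry_diag _ (le_m l) (le_m i)) (negPf (_ : val l != val i)) ?mul0r // eq_sym.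
have extract u : P u -> u 0 0 != 0 -> P (delta_mx 0 0).
  move=> Pu u0; pose c n (l : nat) : K := \prod_(l0 < n) (2%:R ^+ l - 2%:R ^+ l0.+1).
  have Pc n : P (\col_(l < m.+1) (c n l * u l 0)).
    elim: n => [|n IH].
      move: Pu; congr P; apply/matrixP => l j.
      by rewrite (ord1 j) mxE /c big_ord0 mul1r.
    have := kill n.+1 _ IH; congr P; apply/matrixP => l j.
    by rewrite !mxE /c big_ord_recr /= mulrA [_ * (\prod_(_ < _) _)]mulrC.
  apply: (@PZK (c m 0%N * u 0 0)).
    rewrite mulf_neq0 //; apply/prodf_neq0 => l _; rewrite expr0 -opprB oppr_eq0.
    have -> : 2%:R ^+ l.+1 - 1 = ((2 ^ l.+1 - 2).+1)%N%:R :> K; last exact: natK_neq0.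
    apply: (addIr 1); rewrite subrK natr1 -natrX; congr _%:R.
    by rewrite expnS; have := expn_gt0 2 l; rewrite orTb; move: (2 ^ l)%N; lia.
  have := Pc m; congr P; apply/matrixP => l j; rewrite (ord1 j) !mxE eqxx andbT.
  have [->|l0] := eqVneq l 0; first by rewrite mulr1.
  rewrite mulr0; have lm : (l.-1 < m)%N by have := ltn_ord l; move: l0; rewrite -val_eqE /=; lia.
  rewrite /c (bigD1 (Ordinal lm)) //= prednK ?subrr ?mul0r // lt0n.
  by move: l0; rewrite -val_eqE.
(* If the first coordinate is 0, it is made nonzero by the swap when the last one is nonzero, and
   otherwise by y -> x + y acting on the middle vector, which contributes a binomial coefficient. *)
move=> v0 Pv; have [vz|vz] := eqVneq (v 0 0) 0; last exact: extract vz.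
have [vm|vm] := eqVneq (v ord_max 0) 0; last first.
  have us : gl2 0 1 1 0 \in unitmx.
    by apply: gl2_unit; rewrite mul0r mul1r sub0r oppr_eq0 oner_eq0.
  apply: (extract _ (Prho us Pv)); rewrite rhoW_mulE mulf_neq0 //.
    by rewrite expf_neq0 // -unitfE -unitmxE.
  rewrite (bigD1 ord_max) //= (sym_entry_swap (leq0n m) (leqnn m)) add0n eqxx mul1r big1 ?addr0 // => i ne.
  by rewrite (sym_entry_swap (leq0n m) (le_m i)) add0n (negPf (_ : val i != m)%N) ?mul0r.
have [j vj] : exists j, v j 0 != 0.
  apply/existsP; apply: contraNT v0; rewrite negb_exists => /forallP vE.
  by apply/eqP/matrixP => i j; rewrite (ord1 j) mxE; apply/eqP; rewrite -[_ == _]negbK vE.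
have uu : gl2 1 1 0 1 \in unitmx by apply: gl2_unit; rewrite mul1r mul0r subr0 oner_eq0.
apply: (extract _ (Prho uu Pv)); rewrite rhoW_mulE mulf_neq0 //.
  by rewrite expf_neq0 // -unitfE -unitmxE.
have jm : (j <= m)%N by rewrite -ltnS.
have j0 : j != ord0 by apply: contraNneq vj => ->; rewrite vz.
have jmax : j != ord_max by apply: contraNneq vj => ->; rewrite vm.
rewrite (bigD1 j) //= sym_entry_upper // big1 ?addr0 => [|i ne].
  by rewrite mulf_neq0 //; case: 'C(m, j) (bin_gt0 m j) => [|c] H; [rewrite jm in H | apply: natK_neq0].
have [->|i0] := eqVneq i ord0; first by rewrite vz mulr0.
have [->|im] := eqVneq i ord_max; first by rewrite vm mulr0.
exfalso; move: ne j0 jmax i0 im; rewrite -!val_eqE /=.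
by have := ltn_ord i; have := ltn_ord j; lia.
Qed.

End Irreducibility.

Section IsW.
Variables (K : fieldType) (charK : [pchar K] =i pred0).

Lemma rhoW_isW m k : (m <= 2)%N -> isW (m + k, k)%N (@rhoW K m k).
Proof.
move=> m2; split.
- by split=> [|g h _ _]; [exact: rhoW1 | exact: rhoWM].
- pose X : 'M[{mpoly K[2 * 2]}]_2 := \matrix_(i, j) 'X_(mxvec_index i j).
  exists (rhoW m k X) => g _; rewrite rhoW_map; congr rhoW.
  by apply/matrixP => i j; rewrite mxE [X i j]mxE /= mevalXU mxvecE.
- split=> // U Urho; have [->|] := eqVneq U 0%VS; [by left | rewrite -vpick0 => U0; right].
  have Ulin c u v : u \in U -> v \in U -> c *: u + v \in U.
    by move=> Uu Uv; rewrite memvD ?memvZ.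
  have Pe0 := rhoW_highest charK m2 (mem0v U) Ulin Urho U0 (memv_pick U).
  apply/vspaceP => v; rewrite memvf.
  exact: (rhoW_generated m2 (mem0v U) Ulin Urho Pe0).
move=> t1 t2 t10 t20; rewrite /rhoW mxtraceZ /schur2 /=.
have [d00 d01 d10 d11] : [/\ diag2 t1 t2 0 0 = t1, diag2 t1 t2 0 1 = 0,
    diag2 t1 t2 1 0 = 0 & diag2 t1 t2 1 1 = t2].
  by split; rewrite !mxE /= ?mulr1n ?mulr0n.
rewrite det2 d00 d01 d10 d11 mulr0 subr0 exprMn addnK.
rewrite /mxtrace mulr_sumr; apply: eq_bigr => i _; rewrite mxE.
have -> : (m + k - i = (m - i) + k)%N by have := ltn_ord i; lia.
rewrite !exprD /sym_entry d00 d01 d10 d11.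
by case: m m2 i => [|[|[|//]]] _ [[|[|[|//]]] hi] //=; ring.
Qed.

End IsW.

(** * The decomposition of G and its bases over K and S *)

Section Isomorphism.
Variables (K : fieldType) (charK : [pchar K] =i pred0).
Local Notation Om := {mpoly K[nvar]}.
Local Notation x := (tlX K).
Local Notation y := (tlY K).
Local Notation fam := (fam_mx x y).
Implicit Types g : 'M[K]_2.

Definition gl_morph g : {rmorphism Om -> Om} := subst_morph
  (Kscale (g 0 0) (genX K) + Kscale (g 1 0) (genY K))
  (Kscale (g 0 1) (genX K) + Kscale (g 1 1) (genY K)).

Lemma gl_actE g (a : M3 K) : gl_act g a = map_mx (gl_morph g) a.
Proof. by []. Qed.

Lemma gl_actZ g c (a : M3 K) : gl_act g (Kscale c a) = Kscale c (gl_act g a).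
Proof. by rewrite /Kscale gl_actE map_mxZ substC. Qed.
Lemma gl_act_sum g (I : Type) (r : seq I) (F : I -> M3 K) :
  gl_act g (\sum_(i <- r) F i) = \sum_(i <- r) gl_act g (F i).
Proof. exact: (raddf_sum (map_mx (gl_morph g))). Qed.

Definition Kmx g : 'M[Om]_2 := map_mx (@mpolyC nvar K) g.

Lemma gl_tl (p q : K) :
  Kscale p (genX K) + Kscale q (genY K)
  - Kscale 3%:R^-1 (\tr (Kscale p (genX K) + Kscale q (genY K)))%:M =
  p%:MP *: x + q%:MP *: y.
Proof.
rewrite /tlX /tlY /Kscale mxtraceD !mxtraceZ raddfD /= -!scale_scalar_mx scalerDr !scalerBr.
by rewrite opprD addrACA !scalerA [_ * p%:MP]mulrC [_ * q%:MP]mulrC.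
Qed.

Lemma gl_act_x g : map_mx (gl_morph g) x = Kmx g 0 0 *: x + Kmx g 1 0 *: y.
Proof.
rewrite (map_tlX (f := gl_morph g)); last exact: substC.
by rewrite subst_genX gl_tl !mxE.
Qed.

Lemma gl_act_y g : map_mx (gl_morph g) y = Kmx g 0 1 *: x + Kmx g 1 1 *: y.
Proof.
rewrite (map_tlY (f := gl_morph g)); last exact: substC.
by rewrite subst_genY gl_tl !mxE.
Qed.

Lemma gl_act_fam g i j : (i < 9)%N -> (j <= sym_rank i)%N ->
  gl_act g (fam i j) =
  \sum_(l < (sym_rank i).+1) Kscale (rhoW (sym_rank i) (det_rank i) g l (inord j)) (fam i l).
Proof.
move=> i9 ji; rewrite gl_actE /fam_mx nc_sum_fam.
rewrite (f_fam (f := map_mx (gl_morph g)) (gl_act_x g) (gl_act_y g) i9 ji).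
apply: eq_bigr => l _; rewrite nc_sum_fam /Kscale; congr (_ *: _).
have -> : (rhoW (sym_rank i) (det_rank i) g l (inord j))%:MP =
   map_mx (@mpolyC nvar K) (rhoW (sym_rank i) (det_rank i) g) l (inord j) by rewrite [RHS]mxE.
by rewrite rhoW_map 2!mxE inordK.
Qed.

Local Notation lams :=
  [:: (0, 0); (1, 0); (2, 0); (1, 1); (2, 1); (2, 1); (3, 1); (2, 2); (3, 2)]%N.
Local Notation vecs := (forall i : 'I_9, 'cV[K]_(sym_rank i).+1).

Lemma lamE (i : 'I_9) : tnth (in_tuple lams) i = (sym_rank i + det_rank i, det_rank i)%N.
Proof.
rewrite (tnth_nth (0, 0)%N) /=.
have ok : all (fun i => nth (0, 0)%N lams i == (sym_rank i + det_rank i, det_rank i)%N) (iota 0 9).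
  by [].
by apply/eqP; apply: (allP ok); rewrite mem_iota ltn_ord.
Qed.

Definition phi (i : 'I_9) (v : 'cV[K]_(sym_rank i).+1) : M3 K :=
  \sum_l Kscale (v l 0) (fam i l).

Arguments phi : clear implicits.

Lemma phi_lin i c u v : phi i (c *: u + v) = Kscale c (phi i u) + phi i v.
Proof.
rewrite /phi /Kscale scaler_sumr -big_split; apply: eq_bigr => l _.
by rewrite !mxE mpolyCD mpolyCM scalerDl scalerA.
Qed.

Lemma phi0 i : phi i 0 = 0.
Proof. by rewrite /phi big1 // => l _; rewrite mxE /Kscale mpolyC0 scale0r. Qed.

Lemma phi_delta i l : phi i (delta_mx l 0) = fam i l.
Proof.
rewrite /phi (bigD1 l) //= mxE !eqxx /Kscale mpolyC1 scale1r big1 ?addr0 // => l' ne.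
by rewrite mxE (negPf ne) mpolyC0 scale0r.
Qed.

Lemma phi_act i g v :
  phi i (rhoW (sym_rank i) (det_rank i) g *m v) = gl_act g (phi i v).
Proof.
rewrite /phi gl_act_sum.
under [RHS]eq_bigr => l _.
  rewrite gl_actZ (gl_act_fam g (ltn_ord i) (ltn_ord l)) inord_val /Kscale scaler_sumr.
  over.
rewrite exchange_big; apply: eq_bigr => l _ /=.
rewrite /Kscale mxE rmorph_sum scaler_suml; apply: eq_bigr => l' _.
by rewrite scalerA rmorphM mulrC.
Qed.

Definition vec_coef (v : vecs) (i j : nat) : Om :=
  if insub i is Some o then ((v o) (inord j) 0)%:MP else 0.

Lemma sum_phi v : \sum_i phi i (v i) = fam_sum x y (vec_coef v) 0.
Proof.
rewrite /fam_sum scale0r addr0; apply: eq_bigr => i _; apply: eq_bigr => j _.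
by rewrite /vec_coef valK inord_val.
Qed.

(** Linear independence over K is the case of constant coefficients in the independence over S. *)
Lemma phi_free v : \sum_i phi i (v i) = 0 -> forall i, v i = 0.
Proof.
have red := Salg_reduced charK.
rewrite sum_phi => /(fam_sum_free charK)[].
- move=> i j; rewrite /vec_coef; case: insub => [o|]; [exact: SalgC | exact: redS0 red].
- exact: redS0 red.
move=> _ v0 i; apply/matrixP => l j; rewrite (ord1 j) mxE; apply/eqP.
rewrite -(mpolyC_eq0 nvar); apply/eqP; have := v0 i l.
by rewrite /vec_coef valK inord_val; apply; rewrite /fam_index ltn_ord -ltnS ltn_ord.
Qed.

Lemma ulistE : ulist K = [seq ((sym_rank i + det_rank i, det_rank i)%N, fam i 0%N) | i <- iota 0 9].
Proof.
rewrite /ulist /= /fam_mx !nc_sum_fam; move: (x) (y) => a b.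
rewrite /op_el /sym_el /sym_rank /= !expr2 !mulr1 !mulrA.
do 5! congr (_ :: _); congr ((_, _) :: _).
(* [x^2, y] = x [x, y] + [x, y] x. *)
by rewrite /bracket !mulrBr !mulrBl !mulrA addrA subrK.
Qed.

Lemma fam_degE (i : 'I_9) : (sym_rank i + det_rank i + det_rank i)%N = fam_deg i.
Proof.
have ok : all (fun i => sym_rank i + det_rank i + det_rank i == fam_deg i)%N (iota 0 9) by [].
by apply/eqP; apply: (allP ok); rewrite mem_iota ltn_ord.
Qed.

Lemma Gdeg_phi k (a : M3 K) : Gdeg k a ->
  exists v : vecs, (forall i : 'I_9, fam_deg i != k -> v i = 0) /\ a = \sum_i phi i (v i).
Proof.
elim=> [{}a [lam]||c a1 a2 _ [v1 [z1 ->]] _ [v2 [z2 ->]]|g {}a _ _ [v [z ->]]].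
- rewrite ulistE => -[/mapP[i]]; rewrite mem_iota add0n => /andP[_ i9] [-> ->] /= degk.
  pose o := Ordinal i9.
  exists (fun i' : 'I_9 => if i' == o then delta_mx 0 0 else 0); split=> [i' ne|].
    by case: eqP => // e; case/eqP: ne; rewrite e -degk [RHS](fam_degE o).
  rewrite (bigD1 o) //= eqxx phi_delta big1 ?addr0 // => i' /negPf ->.
  exact: phi0.
- by exists (fun _ : 'I_9 => 0); split=> //; rewrite big1 // => i _; apply: phi0.
- exists (fun i : 'I_9 => c *: v1 i + v2 i); split=> [i ne|].
    by rewrite z1 // z2 // scaler0 addr0.
  rewrite /Kscale scaler_sumr -big_split; apply: eq_bigr => i _.
  by rewrite phi_lin.
exists (fun i : 'I_9 => rhoW (sym_rank i) (det_rank i) g *m v i); split=> [i ne|].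
  by rewrite z // mulmx0.
by rewrite gl_act_sum; apply: eq_bigr => i _; rewrite phi_act.
Qed.

(** phi i sends the first basis vector to u_lambda, and that vector generates the whole
    representation. *)
Lemma phi_Gdeg (i : 'I_9) v : Gdeg (fam_deg i) (phi i v).
Proof.
apply: (rhoW_generated (k := det_rank i) (sym_rank2 i)
  (P := fun v => Gdeg (fam_deg i) (phi i v))) => [|c u1 u2 G1 G2|g u ug Gu|].
- by rewrite phi0; constructor 2.
- by rewrite phi_lin; apply: gl_submod_lin.
- by rewrite phi_act; apply: gl_submod_act.
rewrite phi_delta; apply: gl_submod_gen.
exists (sym_rank i + det_rank i, det_rank i)%N; split; last exact: fam_degE.
rewrite ulistE; apply/mapP; exists (val i) => //.
by rewrite mem_iota ltn_ord.
Qed.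

Lemma Gsp_phi a : Gsp a <-> exists v : vecs, a = \sum_i phi i (v i).
Proof.
split=> [[f Gf ->]|[v ->]].
  have {Gf} : forall k : 'I_6, exists v : vecs, f k = \sum_i phi i (v i).
    by move=> k; have [v [_ e]] := Gdeg_phi (Gf k); exists v.
  move=> /fin_all_exists[V fE]; exists (fun i : 'I_9 => \sum_k V k i).
  under eq_bigr => k _ do rewrite fE; rewrite exchange_big; apply: eq_bigr => i _.
  elim/big_rec2: _ => [|k u1 u2 _ ->]; first by rewrite phi0.
  by rewrite -[V k i]scale1r phi_lin /Kscale mpolyC1 !scale1r.
exists (fun k : 'I_6 => \sum_i phi i (if fam_deg i == k then v i else 0)) => [k|].
  elim/big_ind: _ => [|a1 a2 G1 G2|i _].
  - by constructor 2.
  - by rewrite -[a1]scale1r -mpolyC1; apply: gl_submod_lin.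
  case: eqP => [<-|_]; first exact: phi_Gdeg.
  by rewrite phi0; constructor 2.
rewrite exchange_big; apply: eq_bigr => i _ /=.
have i6 : (fam_deg i < 6)%N by rewrite ltnS fam_deg5.
rewrite (bigD1 (Ordinal i6)) //= eqxx big1 ?addr0 // => k ne.
case: eqP => [e|_]; last exact: phi0.
by case/eqP: ne; apply: val_inj; rewrite /= e.
Qed.

Lemma Gdeg_direct (f : 'I_6 -> M3 K) : (forall k : 'I_6, Gdeg k (f k)) ->
  \sum_k f k = 0 -> forall k, f k = 0.
Proof.
move=> Gf; have : forall k : 'I_6, exists v : vecs,
    (forall i : 'I_9, fam_deg i != k -> v i = 0) /\ f k = \sum_i phi i (v i).
  by move=> k; apply: Gdeg_phi.
move=> /fin_all_exists[V fE].
have sumE : \sum_k f k = \sum_i phi i (\sum_k V k i).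
  under eq_bigr => k _ do rewrite (fE k).2; rewrite exchange_big; apply: eq_bigr => i _.
  elim/big_rec2: _ => [|k u1 u2 _ ->]; first by rewrite phi0.
  by rewrite -[V k i]scale1r phi_lin /Kscale mpolyC1 !scale1r.
rewrite sumE => /phi_free V0 k; rewrite (fE k).2 big1 // => i _.
have [ik|ne] := eqVneq (fam_deg i) k; last by rewrite (fE k).1 // phi0.
have := V0 i; rewrite (bigD1 k) //= big1 ?addr0 => [->|k' ne]; first exact: phi0.
by apply: (fE k').1; rewrite ik eq_sym; apply: contraNneq ne => /val_inj ->.
Qed.

Lemma Gsp_iso : iso_sumW (@Gsp K) lams.
Proof.
exists (fun i : 'I_9 => (sym_rank i).+1), (fun i : 'I_9 => rhoW (sym_rank i) (det_rank i)), phi.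
split.
- by move=> i; rewrite lamE; apply: rhoW_isW; rewrite ?sym_rank2.
- exact: phi_lin.
- by move=> i g v _; apply: phi_act.
- exact: Gsp_phi.
exact: phi_free.
Qed.

Lemma fam_Gsp i j : fam_index i j -> Gsp (fam i j).
Proof.
case/andP=> i9 jm; apply/Gsp_phi; pose o := Ordinal i9.
exists (fun i' : 'I_9 => if i' == o then delta_mx (inord j) 0 else 0).
rewrite (bigD1 o) //= eqxx phi_delta big1 ?addr0 => [|i' /negPf ->]; last exact: phi0.
by rewrite inordK.
Qed.

Lemma Gsp_T32 (a : M3 K) : Gsp a -> T32 a.
Proof.
move/Gsp_phi=> [v ->]; rewrite sum_phi; apply: T32_fam_sum => [i j|].
  by rewrite /vec_coef; case: insub => [o|]; rewrite -?mpolyC0; apply: C32C.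
by rewrite -mpolyC0; apply: C32C.
Qed.

Lemma T32_lin_span (a : M3 K) : T32 a <-> lin_span (@C32 K) (@Gsp K) a.
Proof.
have C1 : C32 (1 : Om) by rewrite -mpolyC1; apply: C32C.
split=> [/(T32P charK)[p [q [Sp Sq ->]]]|]; last first.
  elim=> [|p b c Cp Gb _ Tc]; first exact: T32_0.
  by apply: T32D Tc; apply: T32Z => //; apply: Gsp_T32.
suff : mspan (@C32 K) (@Gsp K) (fam_sum x y p q).
  by elim=> [|p' b c Cp Gb _ IH]; [constructor 1 | apply: lin_span_add].
apply: mspanD.
  elim/big_ind: _ => [|a1 a2|i _]; [exact: mspan_zero | exact: mspanD |].
  elim/big_ind: _ => [|a1 a2|j _]; [exact: mspan_zero | exact: mspanD |].
  apply: (mspanZ (@C32M K)); first exact: Salg_C32.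
  by apply: (mspan_gen C1); apply: fam_Gsp; rewrite /fam_index ltn_ord -ltnS ltn_ord.
(* w is itself in C32, so over C32 the element w e is a multiple of 1, which is in G. *)
rewrite -scalemx1 scalerA; apply: (mspanZ (@C32M K)).
  by apply: C32M; [exact: Salg_C32 | exact: C32_w].
apply: (mspan_gen C1); have -> : 1%:M = fam 0 0 by rewrite /fam_mx nc_sum_fam.
exact: fam_Gsp.
Qed.

Lemma GG6P (a : M3 K) : GG6 a <-> exists p q,
  [/\ forall i j, constants (p i j), constants q & a = fam_sum x y p q].
Proof.
split=> [[a1 [a2 [/Gsp_phi[v ->] [c ->] ->]]]|[p [q [Kp [c ->] ->]]]].
  exists (vec_coef v), c%:MP; split.
  - by move=> i j; rewrite /vec_coef; case: insub => [o|]; rewrite -?mpolyC0; eexists.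
  - by exists c.
  by rewrite sum_phi /fam_sum scale0r addr0 wtrE.
exists (fam_sum x y p 0), (Kscale c (wtr K)%:M); split.
- apply/Gsp_phi; exists (fun i : 'I_9 => \col_l (p i l)@_0%MM); rewrite sum_phi /fam_sum; congr (_ + _).
  apply: eq_bigr => i _; apply: eq_bigr => j _; rewrite /vec_coef valK inord_val mxE.
  by have [d ->] := Kp i j; rewrite mcoeffC eqxx mulr1.
- by exists c.
by rewrite /fam_sum scale0r addr0 wtrE.
Qed.

Lemma constants_Salg (p : Om) : constants p -> Salg p.
Proof. by case=> c ->; apply: SalgC. Qed.

Lemma GG6_basis : is_basis (@constants K) (@GG6 K) (@fam_basis K).
Proof.
apply: fam_is_basis; first exact: GG6P.
by move=> p q Kp Kq; apply: fam_sum_free => // *; apply: constants_Salg.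
Qed.

Lemma T32_basis : is_basis (@Salg K) (@T32 K) (@fam_basis K).
Proof. by apply: fam_is_basis; [exact: T32P | exact: fam_sum_free]. Qed.

Lemma Gsp_G6 (a : M3 K) : Gsp a -> G6 a -> a = 0.
Proof.
have red := Salg_reduced charK.
move=> /Gsp_phi[v ->] [c]; rewrite sum_phi wtrE => /eqP; rewrite -subr_eq0 => /eqP e.
have : fam_sum x y (vec_coef v) (- c%:MP) = 0.
  by rewrite -[RHS]e /fam_sum scale0r addr0 scaleNr.
case/(fam_sum_free charK) => [i j||/eqP].
- rewrite /vec_coef; case: insub => [o|]; [exact: SalgC | exact: redS0 red].
- by rewrite -mpolyCN; apply: SalgC.
rewrite oppr_eq0 => /eqP c0 _; move/eqP: e; rewrite subr_eq0 => /eqP ->.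
by rewrite /Kscale c0 scale0r.
Qed.

End Isomorphism.

Theorem theorem2p7 (K : fieldType) (charK : [pchar K] =i pred0) :
  ((forall f : 'I_6 -> M3 K, (forall k : 'I_6, Gdeg k (f k)) ->
      \sum_k f k = 0 -> forall k, f k = 0) /\
   iso_sumW (@Gsp K)
     [:: (0, 0); (1, 0); (2, 0); (1, 1); (2, 1); (2, 1); (3, 1); (2, 2); (3, 2)]%N /\
   (forall a : M3 K, T32 a <-> lin_span (@C32 K) (@Gsp K) a)) /\
  ((exists f : {lrmorphism {mpoly K[10]} -> {mpoly K[nvar]}},
      injective f /\ forall p, Salg p <-> exists q, p = f q) /\
   (forall a : M3 K, Gsp a -> G6 a -> a = 0) /\
   (exists (n : nat) (b : 'I_n -> M3 K), is_basis (@Salg K) (@T32 K) b) /\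
   (forall (n : nat) (b : 'I_n -> M3 K),
      is_basis (@constants K) (@GG6 K) b -> is_basis (@Salg K) (@T32 K) b)).
Proof.
split; first by split; [exact: Gdeg_direct | split; [exact: Gsp_iso | exact: T32_lin_span]].
split; first exact: Salg_polynomial.
split; first exact: Gsp_G6.
split; first by exists 18, (@fam_basis K); apply: T32_basis.
move=> n b bK; have red := Salg_reduced charK.
apply: (is_basis_transfer _ _ _ _ _ _ _ _ _ (GG6_basis charK) bK (T32_basis charK)).
- by exists 0; rewrite mpolyC0.
- by exists 1; rewrite mpolyC1.
- by move=> _ _ [c ->] [d ->]; exists (c + d); rewrite mpolyCD.
- by move=> _ _ [c ->] [d ->]; exists (c * d); rewrite mpolyCM.
- by move=> _ [c ->]; exists (- c); rewrite mpolyCN.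
- exact: redS0 red.
- exact: redSD red.
- exact: redSM red.
exact: constants_Salg.
Qed.
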